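(* For all integers $n>1000$, $$\frac{1}{3}\sqrt{\frac{2\pi}{n}} - 0.0000035462 \le \varepsilon_n \le \frac{1}{3}\sqrt{\frac{2\pi}{n}} + 0.0000021511.$$
   Context: For $x>1$, $\operatorname{li}(x)=\int_0^x \frac{dt}{\ln(t)}$ denotes the logarithmic integral (with the integral across the singularity $t=1$ understood as a Cauchy principal value). For real $x\ge e$, the Stieltjes approximation of $\operatorname{li}(x)$ is $$\operatorname{li}_{*}(x) = \frac{(\ln(x)-n^{*})\,x\,n^{*}!}{\ln^{n^{*}+1}(x)} + \frac{x}{\ln(x)} \sum_{k=0}^{n^{*}-1} \frac{k!}{\ln^{k}(x)}, \qquad n^{*}=\lfloor \ln(x)\rfloor,$$ where $\ln^m(x)$ means $(\ln x)^m$. The Stieltjes approximation error is $\varepsilon(x)=\operatorname{li}_{*}(x)-\operatorname{li}(x)$ for $x\ge e$, and $\varepsilon_k = \varepsilon(e^k)$ for integers $k\ge 1$. *)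

(* Defs.v *)
From Stdlib Require Import Reals ZArith.
From Coquelicot Require Import Coquelicot.

Open Scope R_scope.

(* Both integrals are ordinary Riemann integrals for 0 < h < min(1, x - 1):
   in the library ln 0 = 0 and / 0 = 0, so t |-> 1 / ln t takes at 0 the value
   of its right limit there and is right-continuous at 0. *)
Definition li_truncated (x h : R) : R :=
  RInt (fun t => 1 / ln t) 0 (1 - h) + RInt (fun t => 1 / ln t) (1 + h) x.

(* Cauchy principal value: the limit of li_truncated x h as h -> 0+.  Like RInt,
   this is a total function defined by definite description; it is meant for
   x > 1, where the limit exists. *)
Definition li (x : R) : R :=
  iota (fun l : R => filterlim (li_truncated x) (at_right 0) (locally l)).

(* n^* = floor (ln x); meant for x >= e, hence n^* >= 1. *)
Definition nstar (x : R) : nat := Z.to_nat (Zfloor (ln x)).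

(* sum_f_R0 f m has the m + 1 terms f 0, ..., f m, and nstar x >= 1 for
   x >= e, so the sum runs over 0 <= k <= n^* - 1. *)
Definition li_stieltjes (x : R) : R :=
  (ln x - INR (nstar x)) * x * INR (fact (nstar x)) / ln x ^ (nstar x + 1)
  + x / ln x * sum_f_R0 (fun k => INR (fact k) / ln x ^ k) (nstar x - 1).

Definition stieltjes_error (x : R) : R := li_stieltjes x - li x.

Definition stieltjes_error_exp (k : nat) : R := stieltjes_error (exp (INR k)).

(* Main.v *)
Require Import Defs.
From Stdlib Require Import Reals ZArith Arith Lra Lia Psatz.
From Coquelicot Require Import Coquelicot.

Open Scope R_scope.

(* With N = n, t = exp (- N s), y = 1 + s and phi s = s - ln y, summing the
   geometric series of 1 / ln t shows that
     eps_n = PV int_{-1}^{oo} exp (- N phi s) / s ds.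
   Since phi' s = s / y, the part s / (2 y phi s) of the kernel 1 / s is
   phi' / (2 phi): its weighted integral is a function of phi alone, equal at
   both ends and asymptotically equal on both sides of s = 0, so its principal
   value vanishes.  What remains, (y / s - s / (2 phi s)) / y, is squeezed
   between two functions polynomial / y, whose weighted integrals are
   combinations of factorials:
     eps_n <= or >= M (1/3 - q/n - d (3/n^2 + 6/n^3)),  M = e^n n! / n^(n+1).
   Stirling's bounds sqrt (2 PI / n) <= M <= sqrt (2 PI / n) exp (1 / (12 n)),
   obtained from the Wallis integrals, then give the result.  All integrals are
   evaluated by comparing derivatives on both sides of t = 1. *)

(** * Polynomial bounds for phi *)

Lemma derive_nonneg_le (f df : R -> R) (a b : R) :
  a <= b ->
  (forall t, a <= t <= b -> is_derive f t (df t)) ->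
  (forall t, a <= t <= b -> 0 <= df t) -> f a <= f b.
Proof.
  intros Hab Hd Hp.
  destruct (MVT_gen f a b df) as [c [Hc Heq]];
    rewrite ?(Rmin_left a b), ?(Rmax_right a b) in * by lra.
  - intros x Hx; apply Hd; lra.
  - intros x Hx; apply continuity_pt_filterlim, (ex_derive_continuous f).
    exists (df x); apply Hd; lra.
  - specialize (Hp c Hc). nra.
Qed.

Definition phi (s : R) : R := s - ln (1 + s).

Lemma is_derive_phi (s : R) : -1 < s -> is_derive phi s (s / (1 + s)).
Proof.
  intros Hs; unfold phi; auto_derive; [lra | field; lra].
Qed.

Lemma phi_pos (s : R) : -1 < s -> s <> 0 -> 0 < phi s.
Proof.
  intros Hs H0; unfold phi.
  pose proof (exp_ineq1 s H0).
  assert (ln (1 + s) < ln (exp s)) by (apply ln_increasing; lra).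
  rewrite ln_exp in *; lra.
Qed.

(* The cubic Taylor polynomial of s^2 / (2 phi s) at 0 is
   1 + 2 s / 3 - s^2 / 18 + (4 / 135) s^3; the parameters q < 4 / 135 < q'
   with an odd term of either sign turn it into global bounds. *)
Definition Qpoly (q d s : R) : R :=
  1 + 2 / 3 * s - s ^ 2 / 18 + q * s ^ 3 + d * s ^ 5.

(** Up to the factor [s], the numerator of the derivative of [phi s - s ^ 2 / (2 * Qpoly q d s)]
    over the denominator [2 * (1 + s) * Qpoly q d s ^ 2]. The last bracket is the derivative of
    [Qpoly q d]. *)
Definition Qdefect (q d s : R) : R :=
  2 * Qpoly q d s ^ 2
  - (1 + s) * (2 * Qpoly q d s
               - s * (2 / 3 - s / 9 + 3 * q * s ^ 2 + 5 * d * s ^ 4)).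

Lemma is_derive_phi_sub (q d s : R) : -1 < s -> Qpoly q d s <> 0 ->
  is_derive (fun t => phi t - t ^ 2 / (2 * Qpoly q d t)) s
    (s * Qdefect q d s / (2 * (1 + s) * Qpoly q d s ^ 2)).
Proof.
  intros Hs HQ.
  unfold phi, Qdefect; unfold Qpoly in *; auto_derive.
  - split; [lra | split; [|trivial]]. contradict HQ; lra.
  - field; split; lra.
Qed.

(** The difference vanishes at 0 and its derivative has the sign of [t * Qdefect q d t], so moving
    away from 0 on either side it takes the sign of the defect. The factor [c] encodes that sign; it
    is later [s] or [- s], because the defect changes sign at 0. *)
Lemma phi_Qpoly_compare (c q d s : R) : -1 < s ->
  (forall t, Rmin 0 s <= t <= Rmax 0 s -> 0 < Qpoly q d t) ->
  (forall t, Rmin 0 s <= t <= Rmax 0 s -> 0 <= c * Qdefect q d t) ->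
  0 <= c * (phi s - s ^ 2 / (2 * Qpoly q d s)).
Proof.
  intros Hs HQ HD.
  set (f := fun t => phi t - t ^ 2 / (2 * Qpoly q d t)).
  set (df := fun t => t * Qdefect q d t / (2 * (1 + t) * Qpoly q d t ^ 2)).
  assert (Hf : forall t, Rmin 0 s <= t <= Rmax 0 s -> is_derive f t (df t)).
  { intros t Ht; apply is_derive_phi_sub.
    - revert Ht; unfold Rmin, Rmax; destruct (Rle_dec 0 s); lra.
    - apply Rgt_not_eq, HQ, Ht. }
  assert (Hdf : forall t, Rmin 0 s <= t <= Rmax 0 s -> 0 <= c * t * df t).
  { intros t Ht.
    assert (Ht1 : 0 < 1 + t)
      by (revert Ht; unfold Rmin, Rmax; destruct (Rle_dec 0 s); lra).
    pose proof (HQ t Ht) as HQt.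
    assert (0 < 2 * (1 + t) * Qpoly q d t ^ 2).
    { apply Rmult_lt_0_compat; [lra | apply pow_lt, HQt]. }
    unfold df.
    replace (c * t * (t * Qdefect q d t / (2 * (1 + t) * Qpoly q d t ^ 2)))
      with (t ^ 2 * (c * Qdefect q d t) / (2 * (1 + t) * Qpoly q d t ^ 2))
      by (field; split; lra).
    apply Rmult_le_pos; [|left; apply Rinv_0_lt_compat; assumption].
    apply Rmult_le_pos; [nra | apply HD, Ht]. }
  assert (f0 : f 0 = 0).
  { unfold f, phi, Qpoly. rewrite Rplus_0_r, ln_1. field. }
  assert (Hz : forall t, t = 0 -> 0 <= c * df t).
  { intros t ->; unfold df, Rdiv; rewrite !Rmult_0_l; lra. }
  change (0 <= c * f s).
  replace 0 with (c * f 0) by (rewrite f0; ring).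
  destruct (Rle_dec 0 s) as [H|H].
  - rewrite Rmin_left, Rmax_right in * by lra.
    apply (derive_nonneg_le (fun t => c * f t) (fun t => c * df t)); trivial.
    + intros t Ht; apply (is_derive_scal f), Hf, Ht.
    + intros t Ht; destruct (Req_dec t 0); [auto|].
      specialize (Hdf t Ht). apply Rmult_le_reg_l with t; [lra|]; cbv beta; lra.
  - rewrite Rmin_right, Rmax_left in * by lra.
    enough (- (c * f s) <= - (c * f 0)) by lra.
    apply (derive_nonneg_le (fun t => - (c * f t)) (fun t => - (c * df t))); [lra| |].
    + intros t Ht. apply (is_derive_opp (fun u => c * f u)), (is_derive_scal f), Hf, Ht.
    + intros t Ht; destruct (Req_dec t 0) as [->|].
      * unfold df, Rdiv; rewrite !Rmult_0_l; lra.
      * specialize (Hdf t Ht). apply Rmult_le_reg_l with (- t); [lra|]; cbv beta; lra.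
Qed.

Lemma Qpoly_upper_pos (t : R) : -1 < t <= 1 -> 0 < Qpoly (1 / 60) (-1) t.
Proof.
  intros Ht; unfold Qpoly.
  assert (0 <= t ^ 2 <= 1) by nra.
  assert (0 <= t ^ 4 <= 1) by (replace (t ^ 4) with (t ^ 2 * t ^ 2) by ring; nra).
  replace (t ^ 3) with (t * t ^ 2) by ring.
  replace (t ^ 5) with (t * t ^ 4) by ring.
  destruct (Rle_dec 0 t); nra.
Qed.

(** Agreement with the Taylor polynomial through degree 2 lets [t ^ 3] factor out, and the constant
    term of [p] is 5 (4/135 - q), here 7/108. The term [- s ^ 5] of [Qpoly] contributes [7 * t ^ 2]
    to [p], which keeps it nonnegative. *)
Lemma Qdefect_upper (t : R) : -1 <= t <= 1 ->
  exists p, 0 <= p /\ Qdefect (1 / 60) (-1) t = - (t ^ 3 * p).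
Proof.
  intros Ht.
  exists (7/108 - 109/1620 * t + t ^ 2 * (1891/270 + 10199/1800 * t
          - 2/9 * t^2 + 1/15 * (t * t^2) - 2 * (t * t^4))).
  split; [|unfold Qdefect, Qpoly; field].
  assert (0 <= t ^ 2 <= 1) by nra.
  assert (0 <= t ^ 4 <= 1) by (replace (t ^ 4) with (t ^ 2 * t ^ 2) by ring; nra).
  (* With this bracket at least 1, [p] is bounded below by a quadratic in [t] of negative
     discriminant. *)
  assert (1 <= 1891/270 + 10199/1800 * t
          - 2/9 * t^2 + 1/15 * (t * t^2) - 2 * (t * t^4))
    by (destruct (Rle_dec 0 t); nra).
  nra.
Qed.

(** The constant term of [p] is now 5 (1/30 - 4/135) = 1/54. The range stops at -17/20 because
    [Qpoly (1 / 30) 1] is already negative there, and a nonpositive polynomial value is a separate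
    easy case. *)
Lemma Qdefect_lower (t : R) : -17 / 20 <= t ->
  exists p, 0 <= p /\ Qdefect (1 / 30) 1 t = t ^ 3 * p.
Proof.
  intros Ht.
  exists (1/54 + 52/405 * t + t ^ 2 * (944/135 + 2551/450 * t
          - 2/9 * t^2 + 2/15 * (t * t^2) + 2 * (t * t^4))).
  split; [|unfold Qdefect, Qpoly; field].
  assert (1 / 4 <= 944/135 + 2551/450 * t
          - 2/9 * t^2 + 2/15 * (t * t^2) + 2 * (t * t^4)).
  { destruct (Rle_dec 0 t).
    - assert (0 <= t * t ^ 4) by (apply Rmult_le_pos; [|apply pow_le]; assumption).
      assert (0 <= t * (t - 1) ^ 2) by (apply Rmult_le_pos; [|apply pow2_ge_0]; assumption).
      nra.
    - assert (0 <= t ^ 2 <= 289 / 400) by nra.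
      assert (0 <= t ^ 4 <= 53 / 100)
        by (replace (t ^ 4) with (t ^ 2 * t ^ 2) by ring; nra).
      nra. }
  apply Rle_trans with (1/54 + 52/405 * t + t ^ 2 * (1 / 4)).
  (* Completes the square of t^2/4 + 52 t/405. *)
  { pose proof (pow2_ge_0 (t + 104 / 405)); lra. }
  apply Rplus_le_compat_l, Rmult_le_compat_l; [apply pow2_ge_0 | assumption].
Qed.

(** Division by [s] reverses inequalities for [s < 0], so the Taylor error
    [s ^ 2 / (2 * phi s) - Qpoly] must have the sign of [s]. Its odd leading term (4/135 - q) s^3
    makes this possible. *)
Lemma Qpoly_upper (s : R) : -1 < s -> s <> 0 ->
  Qpoly (1 / 60) (-1) s / s <= s / (2 * phi s).
Proof.
  intros Hs H0.
  pose proof (phi_pos s Hs H0) as Hphi.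
  assert (Hdiv : forall A, 0 <= s * (s ^ 2 - 2 * phi s * A) -> A / s <= s / (2 * phi s)).
  { intros A HA.
    enough (0 <= s / (2 * phi s) - A / s) by lra.
    replace (s / (2 * phi s) - A / s)
      with (s * (s ^ 2 - 2 * phi s * A) / (s ^ 2 * (2 * phi s))) by (field; lra).
    apply Rmult_le_pos; [exact HA|].
    left; apply Rinv_0_lt_compat, Rmult_lt_0_compat; nra. }
  apply Hdiv; clear Hdiv.
  (* The polynomial eventually becomes negative, so the derivative comparison is confined to
     [s < 1]; beyond, [Qpoly <= 1] and [2 * phi s <= s ^ 2] suffice. *)
  destruct (Rle_dec 1 s) as [H1|H1].
  - assert (phi s <= s ^ 2 / 2).
    { enough (0 <= s ^ 2 / 2 - phi s) by lra.
      replace 0 with (0 ^ 2 / 2 - phi 0)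
        by (unfold phi; rewrite Rplus_0_r, ln_1; field).
      apply (derive_nonneg_le (fun t => t ^ 2 / 2 - phi t) (fun t => t ^ 2 / (1 + t)));
        [lra| |].
      - intros t Ht; unfold phi; auto_derive; [lra | field; lra].
      - intros t Ht; apply Rmult_le_pos; [nra | left; apply Rinv_0_lt_compat; lra]. }
    assert (Qpoly (1 / 60) (-1) s <= 1).
    { unfold Qpoly.
      assert (1 <= s ^ 2) by nra.
      assert (0 <= s * (s ^ 2 * (s ^ 2 - 1))) by (repeat apply Rmult_le_pos; lra).
      replace (s ^ 3) with (s * s ^ 2) by ring.
      replace (s ^ 5) with (s * (s ^ 2 * s ^ 2)) by ring. nra. }
    apply Rmult_le_pos; nra.
  - assert (HQ : forall t, Rmin 0 s <= t <= Rmax 0 s -> 0 < Qpoly (1 / 60) (-1) t).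
    { intros t Ht; apply Qpoly_upper_pos.
      revert Ht; unfold Rmin, Rmax; destruct (Rle_dec 0 s); lra. }
    assert (HQs : 0 < Qpoly (1 / 60) (-1) s) by (apply Qpoly_upper_pos; lra).
    set (A := Qpoly (1 / 60) (-1) s) in *.
    assert (Hc : 0 <= - s * (phi s - s ^ 2 / (2 * A))).
    { apply phi_Qpoly_compare; trivial.
      intros t Ht.
      destruct (Qdefect_upper t) as [p [Hp ->]].
      { revert Ht; unfold Rmin, Rmax; destruct (Rle_dec 0 s); lra. }
      (* Between 0 and [s], the point [t] has the sign of [s]; this is why [c = - s] works on both
         sides. *)
      replace (- s * - (t ^ 3 * p)) with (s * t * (t ^ 2 * p)) by ring.
      apply Rmult_le_pos; [|nra].
      revert Ht; unfold Rmin, Rmax; destruct (Rle_dec 0 s); nra. }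
    replace (s * (s ^ 2 - 2 * phi s * A))
      with (2 * A * (- s * (phi s - s ^ 2 / (2 * A)))) by (field; lra).
    apply Rmult_le_pos; lra.
Qed.

Lemma Qpoly_lower (s : R) : -1 < s -> s <> 0 ->
  s / (2 * phi s) <= Qpoly (1 / 30) 1 s / s.
Proof.
  intros Hs H0.
  pose proof (phi_pos s Hs H0) as Hphi.
  assert (Hdiv : forall A, 0 <= s * (2 * phi s * A - s ^ 2) -> s / (2 * phi s) <= A / s).
  { intros A HA.
    enough (0 <= A / s - s / (2 * phi s)) by lra.
    replace (A / s - s / (2 * phi s))
      with (s * (2 * phi s * A - s ^ 2) / (s ^ 2 * (2 * phi s))) by (field; lra).
    apply Rmult_le_pos; [exact HA|].
    left; apply Rinv_0_lt_compat, Rmult_lt_0_compat; nra. }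
  apply Hdiv; clear Hdiv.
  assert (Hmono : forall t u, t <= u -> u <= 0 -> -1 < t ->
            Qpoly (1 / 30) 1 t <= Qpoly (1 / 30) 1 u).
  { intros t u Htu Hu Ht.
    apply (derive_nonneg_le (Qpoly (1 / 30) 1)
      (fun t => 2 / 3 - t / 9 + t ^ 2 / 10 + 5 * (t ^ 2) ^ 2)); trivial.
    - intros v Hv; unfold Qpoly; auto_derive; [trivial | field].
    - intros v Hv; nra. }
  assert (Hnn : forall t, 0 <= t -> 0 < Qpoly (1 / 30) 1 t).
  { intros t Ht; unfold Qpoly.
    assert (0 <= t ^ 5) by (apply pow_le, Ht).
    assert (0 <= t * (t - 1) ^ 2) by (apply Rmult_le_pos; [|apply pow2_ge_0]; assumption).
    nra. }
  set (A := Qpoly (1 / 30) 1 s).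
  (* If [A <= 0] then [s < 0], so [A / s] is nonnegative while [s / (2 * phi s)] is negative. *)
  destruct (Rle_dec A 0) as [HQ0|HQ0].
  - assert (s < 0).
    { apply Rnot_le_lt; intros Hs0; specialize (Hnn s Hs0); fold A in Hnn; lra. }
    assert (0 <= phi s * - A) by (apply Rmult_le_pos; lra).
    nra.
  - assert (HQ : forall t, Rmin 0 s <= t <= Rmax 0 s -> 0 < Qpoly (1 / 30) 1 t).
    { intros t Ht; destruct (Rle_dec 0 t) as [Ht0|Ht0]; [auto|].
      apply Rlt_le_trans with A; [lra|].
      revert Ht; unfold Rmin, Rmax; destruct (Rle_dec 0 s); intros Ht; [lra|].
      apply Hmono; lra. }
    (* Further left, monotonicity would bound [A] by the negative value at -17/20. *)
    assert (Hs1 : -17 / 20 <= s).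
    { apply Rnot_lt_le; intros Hlt; apply HQ0.
      apply Rle_trans with (Qpoly (1 / 30) 1 (-17 / 20)); [apply Hmono; lra|].
      unfold Qpoly; lra. }
    assert (Hc : 0 <= s * (phi s - s ^ 2 / (2 * A))).
    { apply phi_Qpoly_compare; trivial.
      intros t Ht.
      destruct (Qdefect_lower t) as [p [Hp ->]].
      { revert Ht; unfold Rmin, Rmax; destruct (Rle_dec 0 s); lra. }
      replace (s * (t ^ 3 * p)) with (s * t * (t ^ 2 * p)) by ring.
      apply Rmult_le_pos; [|nra].
      revert Ht; unfold Rmin, Rmax; destruct (Rle_dec 0 s); nra. }
    replace (s * (2 * phi s * A - s ^ 2))
      with (2 * A * (s * (phi s - s ^ 2 / (2 * A)))) by (field; lra).
    apply Rmult_le_pos; lra.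
Qed.

(** * Wallis integrals and Stirling's bounds *)

Ltac positivity := repeat first
  [ assumption | apply PI_RGT_0 | apply exp_pos | apply Rmult_lt_0_compat
  | apply Rinv_0_lt_compat | apply Rdiv_lt_0_compat | apply pow_lt | lra ].

Definition wallis (k : nat) : R := RInt (fun x => sin x ^ k) 0 (PI / 2).

Lemma ex_RInt_sin_pow (k : nat) (a b : R) : ex_RInt (fun x => sin x ^ k) a b.
Proof.
  apply (@ex_RInt_continuous R_CompleteNormedModule); intros z _.
  apply (ex_derive_continuous (fun x => sin x ^ k)); auto_derive; trivial.
Qed.

Lemma wallis_0 : wallis 0 = PI / 2.
Proof.
  unfold wallis; simpl; rewrite RInt_const. unfold scal; simpl; unfold mult; simpl; ring.
Qed.

Lemma is_RInt_of_derive (f df : R -> R) (a b v : R) :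
  (forall x, is_derive f x (df x)) -> (forall x, ex_derive df x) ->
  f b - f a = v -> is_RInt df a b v.
Proof.
  intros Hf Hdf <-; apply (is_RInt_derive f); intros x _; [apply Hf|].
  apply (ex_derive_continuous df), Hdf.
Qed.

Lemma wallis_1 : wallis 1 = 1.
Proof.
  apply is_RInt_unique, (is_RInt_of_derive (fun x => - cos x)).
  - intros x; auto_derive; [trivial | ring].
  - intros x; auto_derive; trivial.
  - rewrite cos_PI2, cos_0; ring.
Qed.

(** Integration by parts: - sin^(k+1) cos vanishes at both endpoints, and its derivative is the
    difference of the two integrands. *)
Lemma wallis_rec (k : nat) : INR (k + 2) * wallis (k + 2) = INR (k + 1) * wallis k.
Proof.
  enough (H : is_RInt (fun x => INR (k + 2) * sin x ^ (k + 2) - INR (k + 1) * sin x ^ k)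
            0 (PI / 2) 0).
  { assert (H' : is_RInt (fun x => INR (k + 2) * sin x ^ (k + 2) - INR (k + 1) * sin x ^ k)
            0 (PI / 2) (INR (k + 2) * wallis (k + 2) - INR (k + 1) * wallis k)).
    { apply (is_RInt_minus (V := R_NormedModule)
        (fun x => INR (k + 2) * sin x ^ (k + 2)) (fun x => INR (k + 1) * sin x ^ k));
        apply (is_RInt_scal (V := R_NormedModule));
        apply (@RInt_correct R_CompleteNormedModule), ex_RInt_sin_pow. }
    apply (@is_RInt_unique R_CompleteNormedModule) in H, H'. lra. }
  apply (is_RInt_of_derive (fun x => - (sin x ^ (k + 1) * cos x))).
  - intros x; auto_derive; [trivial|].
    replace (k + 2)%nat with (S (S k)) by lia.
    replace (k + 1)%nat with (S k) by lia.
    pose proof (sin2_cos2 x) as Hsc; unfold Rsqr in Hsc.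
    rewrite (S_INR (S k)). simpl pred. simpl pow.
    replace (1 * cos x * (INR (S k) * sin x ^ k) * cos x)
      with (INR (S k) * sin x ^ k * (cos x * cos x)) by ring.
    replace (cos x * cos x) with (1 - sin x * sin x) by lra.
    ring.
  - intros x; auto_derive; trivial.
  - rewrite cos_PI2, sin_0, cos_0, Nat.add_1_r; simpl; ring.
Qed.

Lemma wallis_pos (k : nat) : 0 < wallis k.
Proof.
  pose proof PI_RGT_0.
  apply RInt_gt_0; [lra| |].
  - intros x Hx; apply pow_lt, sin_gt_0; lra.
  - intros x Hx; apply continuity_pt_filterlim, continuity_pt_filterlim.
    apply (ex_derive_continuous (fun x => sin x ^ k)); auto_derive; trivial.
Qed.

Lemma wallis_decr (k : nat) : wallis (S k) <= wallis k.
Proof.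
  pose proof PI_RGT_0.
  apply RInt_le; try apply ex_RInt_sin_pow; [lra|].
  intros x Hx; simpl.
  assert (0 <= sin x ^ k) by (apply pow_le, sin_ge_0; lra).
  pose proof (SIN_bound x). nra.
Qed.

Lemma wallis_mul (k : nat) : INR (k + 1) * (wallis (S k) * wallis k) = PI / 2.
Proof.
  induction k as [|k IH].
  - simpl; rewrite wallis_0, wallis_1; ring.
  - rewrite <- IH.
    replace (S k + 1)%nat with (k + 2)%nat by lia.
    replace (S (S k)) with (k + 2)%nat by lia.
    rewrite <- Rmult_assoc, wallis_rec; ring.
Qed.

Lemma wallis_even (m : nat) :
  wallis (2 * m) = INR (fact (2 * m)) / (4 ^ m * INR (fact m) ^ 2) * (PI / 2).
Proof.
  induction m as [|m IH].
  - simpl; rewrite wallis_0; field.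
  - replace (2 * S m)%nat with (2 * m + 2)%nat by lia.
    apply Rmult_eq_reg_l with (INR (2 * m + 2)); [|apply not_0_INR; lia].
    rewrite wallis_rec, IH.
    replace (2 * m + 2)%nat with (S (S (2 * m))) by lia.
    replace (2 * m + 1)%nat with (S (2 * m)) by lia.
    rewrite !fact_simpl, !mult_INR, !S_INR, mult_INR.
    simpl (4 ^ S m). change (INR 2) with 2.
    field; repeat split; try apply INR_fact_neq_0;
      try (apply pow_nonzero; lra); pose proof (pos_INR m); lra.
Qed.

(** By monotonicity the square lies between the products with the next and with the previous Wallis
    integral, both known from [wallis_mul]. *)
Lemma wallis_even_sqr_bounds (m : nat) : (0 < m)%nat ->
  PI / (2 * (2 * INR m + 1)) <= wallis (2 * m) ^ 2 <= PI / (4 * INR m).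
Proof.
  intros Hm.
  assert (0 < INR m) by (apply lt_0_INR; lia).
  pose proof (wallis_pos (2 * m)).
  split.
  - pose proof (wallis_mul (2 * m)) as Hmul.
    pose proof (wallis_decr (2 * m)).
    rewrite plus_INR, mult_INR in Hmul.
    set (w := wallis (2 * m)) in *; set (v := wallis (S (2 * m))) in *; clearbody v w.
    change (INR 2) with 2 in Hmul; change (INR 1) with 1 in Hmul.
    replace (PI / (2 * (2 * INR m + 1))) with (PI / 2 / (2 * INR m + 1)) by (field; lra).
    rewrite <- Hmul.
    replace ((2 * INR m + 1) * (v * w) / (2 * INR m + 1)) with (v * w) by (field; lra).
    nra.
  - pose proof (wallis_mul (2 * m - 1)) as Hmul.
    pose proof (wallis_decr (2 * m - 1)).
    replace (S (2 * m - 1)) with (2 * m)%nat in * by lia.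
    replace (2 * m - 1 + 1)%nat with (2 * m)%nat in * by lia.
    rewrite mult_INR in Hmul.
    set (w := wallis (2 * m)) in *; set (v := wallis (2 * m - 1)) in *; clearbody v w.
    change (INR 2) with 2 in Hmul.
    replace (PI / (4 * INR m)) with (PI / 2 / (2 * INR m)) by (field; lra).
    rewrite <- Hmul.
    replace (2 * INR m * (w * v) / (2 * INR m)) with (w * v) by (field; lra).
    nra.
Qed.

(** The logarithm of n! e^n / n^(n + 1/2), which decreases to ln (2 PI) / 2. *)
Definition stirling_log (n : nat) : R :=
  ln (INR (fact n)) + INR n - (INR n + 1 / 2) * ln (INR n).

Lemma ln_1p_lower (x : R) : 0 <= x -> 2 * x / (2 + x) <= ln (1 + x).
Proof.
  intros Hx.
  enough (0 <= ln (1 + x) - 2 * x / (2 + x)) by lra.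
  replace 0 with (ln (1 + 0) - 2 * 0 / (2 + 0)) by (rewrite !Rplus_0_r, ln_1; field).
  apply (derive_nonneg_le (fun x => ln (1 + x) - 2 * x / (2 + x))
    (fun x => x ^ 2 / ((1 + x) * (2 + x) ^ 2))); [lra| |].
  - intros t Ht; auto_derive; [lra | field; lra].
  - intros t Ht; apply Rmult_le_pos; [nra|].
    left; apply Rinv_0_lt_compat, Rmult_lt_0_compat; [|apply pow_lt]; lra.
Qed.

(** At x = 1/n the correction factor produces exactly 1 / (12 n (n + 1)), which telescopes in
    [stirling_log_step]. *)
Lemma ln_1p_upper (x : R) : 0 <= x ->
  ln (1 + x) <= 2 * x / (2 + x) * (1 + x ^ 2 / (12 * (1 + x))).
Proof.
  intros Hx.
  set (f := fun x => 2 * x / (2 + x) * (1 + x ^ 2 / (12 * (1 + x))) - ln (1 + x)).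
  enough (H : f 0 <= f x).
  { unfold f in H; rewrite !Rplus_0_r, ln_1 in H; lra. }
  apply (derive_nonneg_le f (fun x => x ^ 4 / (6 * (1 + x) ^ 2 * (2 + x) ^ 2))); [lra| |].
  - intros t Ht; unfold f; auto_derive; [lra | field; lra].
  - intros t Ht; apply Rmult_le_pos; [apply pow_le; lra|].
    left; apply Rinv_0_lt_compat; repeat apply Rmult_lt_0_compat; lra.
Qed.

Lemma stirling_log_step (n : nat) : (0 < n)%nat ->
  0 <= stirling_log n - stirling_log (S n)
    <= 1 / (12 * INR n) - 1 / (12 * INR (S n)).
Proof.
  intros Hn; unfold stirling_log.
  assert (Hn0 : 0 < INR n) by (apply lt_0_INR; lia).
  rewrite fact_simpl, mult_INR, ln_mult, S_INR by (apply lt_0_INR; try apply lt_O_fact; lia).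
  set (x := / INR n).
  assert (0 < x) by (apply Rinv_0_lt_compat; lra).
  replace (INR n + 1) with (INR n * (1 + x)) by (unfold x; field; lra).
  rewrite ln_mult by lra.
  set (L := ln (INR n)). set (F := ln (INR (fact n))).
  pose proof (ln_1p_lower x ltac:(lra)) as H1.
  pose proof (ln_1p_upper x ltac:(lra)) as H2.
  set (l := ln (1 + x)) in *.
  assert (HN : INR n = / x) by (unfold x; field; lra).
  rewrite HN. clearbody x l L F.
  (* With x = 1/n, this difference is (n + 1/2) ln (1 + 1/n) - 1. *)
  assert (E1 : F + / x - (/ x + 1 / 2) * L -
    (L + l + F + / x * (1 + x) - (/ x * (1 + x) + 1 / 2) * (L + l))
    = (l - 2 * x / (2 + x)) * ((2 + x) / (2 * x))) by (field; lra).
  rewrite E1.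
  assert (0 < (2 + x) / (2 * x)) by (apply Rdiv_lt_0_compat; lra).
  split.
  - apply Rmult_le_pos; lra.
  - replace (1 / (12 * / x) - 1 / (12 * (/ x * (1 + x))))
      with ((2 * x / (2 + x) * (1 + x ^ 2 / (12 * (1 + x))) - 2 * x / (2 + x))
            * ((2 + x) / (2 * x))) by (field; lra).
    apply Rmult_le_compat_r; lra.
Qed.

Lemma stirling_log_diff (n k : nat) : (0 < n)%nat ->
  0 <= stirling_log n - stirling_log (n + k)
    <= 1 / (12 * INR n) - 1 / (12 * INR (n + k)).
Proof.
  intros Hn; induction k as [|k IH].
  - rewrite Nat.add_0_r; lra.
  - pose proof (stirling_log_step (n + k) ltac:(lia)).
    rewrite <- plus_n_Sm; lra.
Qed.

(** This combination has the same limit as [stirling_log] itself, and its factorials form the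
    central binomial quotient in [wallis_even]; the Wallis bounds thus identify the constant. *)
Lemma stirling_log_wallis (m : nat) : (0 < m)%nat ->
  ln (2 * PI) / 2 <= 2 * stirling_log m - stirling_log (2 * m)
    <= ln (2 * PI) / 2 + 1 / (4 * INR m).
Proof.
  intros Hm.
  pose proof PI_RGT_0 as HPI.
  assert (Hm0 : 0 < INR m) by (apply lt_0_INR; lia).
  destruct (wallis_even_sqr_bounds m Hm) as [Hl Hu].
  pose proof (wallis_pos (2 * m)) as Hw.
  assert (Hfm : 0 < INR (fact m)) by apply INR_fact_lt_0.
  assert (Hf2 : 0 < INR (fact (2 * m))) by apply INR_fact_lt_0.
  assert (H4 : 0 < 4 ^ m) by (apply pow_lt; lra).
  assert (Hlw : ln (wallis (2 * m)) = ln (INR (fact (2 * m)))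
            - 2 * INR m * ln 2 - 2 * ln (INR (fact m)) + ln PI - ln 2).
  { rewrite wallis_even.
    unfold Rdiv. rewrite !ln_mult, !ln_Rinv, ln_mult, !ln_pow by positivity.
    replace 4 with (2 * 2) by ring. rewrite ln_mult by lra.
    change (INR 2) with 2. ring. }
  assert (E : 2 * stirling_log m - stirling_log (2 * m)
              = (2 * ln PI - ln 2 - ln (INR m) - 2 * ln (wallis (2 * m))) / 2).
  { rewrite Hlw; unfold stirling_log. rewrite mult_INR; change (INR 2) with 2.
    rewrite (ln_mult 2) by lra. field. }
  rewrite E; clear E.
  assert (Hw2 : 2 * ln (wallis (2 * m)) = ln (wallis (2 * m) ^ 2))
    by (rewrite ln_pow by lra; change (INR 2) with 2; ring).
  rewrite Hw2, (ln_mult 2 PI) by lra.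
  split.
  - apply ln_le in Hu; [|apply pow_lt; lra].
    unfold Rdiv in Hu; rewrite ln_mult, ln_Rinv, ln_mult in Hu by positivity.
    replace 4 with (2 * 2) in Hu by ring; rewrite ln_mult in Hu by lra. lra.
  - apply ln_le in Hl; [|apply Rdiv_lt_0_compat; lra].
    replace (2 * (2 * INR m + 1)) with (2 * 2 * INR m * (1 + / (2 * INR m))) in Hl
      by (field; lra).
    assert (Hi : 0 < / (2 * INR m)) by (apply Rinv_0_lt_compat; lra).
    unfold Rdiv in Hl; rewrite ln_mult, ln_Rinv, !ln_mult in Hl by positivity.
    assert (ln (1 + / (2 * INR m)) <= / (2 * INR m)).
    { rewrite <- (ln_exp (/ (2 * INR m))) at 2.
      apply ln_le; [lra|]. left; apply exp_ineq1; lra. }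
    replace (1 / (4 * INR m)) with (/ (2 * INR m) / 2) by (field; lra).
    lra.
Qed.

Lemma le_of_le_plus_inv (a b c : R) (k : nat) : 0 <= c ->
  (forall m, (k <= m)%nat -> (0 < m)%nat -> a <= b + c / INR m) -> a <= b.
Proof.
  intros Hc H; apply le_epsilon; intros eps Heps.
  destruct (nfloor_ex (c / eps)) as [p [_ Hp]].
  { apply Rmult_le_pos; [lra | left; apply Rinv_0_lt_compat; lra]. }
  apply Rle_trans with (b + c / INR (p + 1 + k)); [apply H; lia|].
  apply Rplus_le_compat_l.
  assert (0 < INR (p + 1 + k)) by (apply lt_0_INR; lia).
  assert (c / eps <= INR (p + 1 + k)).
  { rewrite !plus_INR; change (INR 1) with 1. pose proof (pos_INR k); lra. }
  apply Rmult_le_reg_r with (INR (p + 1 + k)); [lra|].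
  replace (c / INR (p + 1 + k) * INR (p + 1 + k)) with (c / eps * eps) by (field; lra).
  nra.
Qed.

Lemma stirling_log_bounds (n : nat) : (0 < n)%nat ->
  ln (2 * PI) / 2 <= stirling_log n <= ln (2 * PI) / 2 + 1 / (12 * INR n).
Proof.
  intros Hn.
  (* [stirling_log m] and [stirling_log (2 * m)] differ by at most 1/(24 m), so the Wallis
     combination pins [stirling_log m] within 1/m of the constant. Letting m grow in the telescoped
     bound from n to m concludes. *)
  assert (Hm : forall m, (0 < m)%nat ->
    ln (2 * PI) / 2 <= stirling_log m + 1 / INR m /\
    stirling_log m <= ln (2 * PI) / 2 + 1 / INR m).
  { intros m Hm.
    pose proof (stirling_log_wallis m Hm).
    pose proof (stirling_log_diff m m Hm) as Hd.
    replace (m + m)%nat with (2 * m)%nat in Hd by lia.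
    rewrite mult_INR in Hd; change (INR 2) with 2 in Hd.
    assert (0 < INR m) by (apply lt_0_INR; lia).
    assert (0 < 1 / INR m) by (apply Rdiv_lt_0_compat; lra).
    replace (1 / (12 * INR m)) with (1 / INR m / 12) in * by (field; lra).
    replace (1 / (12 * (2 * INR m))) with (1 / INR m / 24) in * by (field; lra).
    replace (1 / (4 * INR m)) with (1 / INR m / 4) in * by (field; lra).
    lra. }
  assert (Hd : forall m, (n <= m)%nat ->
    0 <= stirling_log n - stirling_log m <= 1 / (12 * INR n)).
  { intros m Hnm.
    pose proof (stirling_log_diff n (m - n) Hn) as Hd.
    replace (n + (m - n))%nat with m in Hd by lia.
    assert (0 < 1 / (12 * INR m)).
    { apply Rdiv_lt_0_compat; [lra|]. assert (0 < INR m) by (apply lt_0_INR; lia). lra. }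
    lra. }
  split; apply (le_of_le_plus_inv _ _ 1 n); try lra; intros m Hnm Hm0;
    specialize (Hd m Hnm); specialize (Hm m Hm0); lra.
Qed.

Lemma exp_le_compat (x y : R) : x <= y -> exp x <= exp y.
Proof. intros [H| ->]; [left; apply exp_increasing, H | lra]. Qed.

Definition stirling_ratio (n : nat) : R :=
  exp (INR n) * INR (fact n) / INR n ^ (n + 1).

Lemma stirling_ratio_bounds (n : nat) : (0 < n)%nat ->
  sqrt (2 * PI / INR n) <= stirling_ratio n
    <= sqrt (2 * PI / INR n) * exp (1 / (12 * INR n)).
Proof.
  intros Hn.
  pose proof PI_RGT_0.
  assert (Hn0 : 0 < INR n) by (apply lt_0_INR; lia).
  pose proof (INR_fact_lt_0 n).
  assert (Hp : 0 < INR n ^ (n + 1)) by (apply pow_lt; lra).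
  assert (H2 : 0 < 2 * PI / INR n) by (apply Rdiv_lt_0_compat; lra).
  assert (Hr : stirling_ratio n = exp (stirling_log n - ln (INR n) / 2)).
  { rewrite <- (exp_ln (stirling_ratio n)).
    - f_equal; unfold stirling_ratio, stirling_log, Rdiv.
      pose proof (exp_pos (INR n)).
      rewrite !ln_mult, ln_exp, ln_Rinv, ln_pow, plus_INR by positivity. change (INR 1) with 1. field.
    - apply Rdiv_lt_0_compat; [|lra]. apply Rmult_lt_0_compat; [apply exp_pos | lra]. }
  assert (Hs : sqrt (2 * PI / INR n) = exp (ln (2 * PI) / 2 - ln (INR n) / 2)).
  { rewrite <- (exp_ln (sqrt (2 * PI / INR n))) by (apply sqrt_lt_R0, H2).
    f_equal.
    assert (Hq : ln (2 * PI / INR n) = 2 * ln (sqrt (2 * PI / INR n))).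
    { pose proof (sqrt_lt_R0 _ H2).
      rewrite <- (sqrt_sqrt (2 * PI / INR n)) at 1 by lra.
      rewrite ln_mult by assumption; ring. }
    unfold Rdiv at 1 in Hq; rewrite ln_mult, ln_Rinv in Hq by positivity; lra. }
  rewrite Hr, Hs, <- exp_plus.
  pose proof (stirling_log_bounds n Hn).
  split; apply exp_le_compat; lra.
Qed.

(** * The principal value defining li *)

Lemma filterlim_Rplus {T : Type} {F : (T -> Prop) -> Prop} {FF : Filter F}
  (f g : T -> R) (a b : R) :
  filterlim f F (locally a) -> filterlim g F (locally b) ->
  filterlim (fun t => f t + g t) F (locally (a + b)).
Proof.
  intros Hf Hg; eapply filterlim_comp_2; [exact Hf | exact Hg|].
  apply (filterlim_plus (V := R_NormedModule)).
Qed.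

Lemma filterlim_Rscal {T : Type} {F : (T -> Prop) -> Prop} {FF : Filter F}
  (c : R) (f : T -> R) (a : R) :
  filterlim f F (locally a) -> filterlim (fun t => c * f t) F (locally (c * a)).
Proof.
  intros Hf; exact (filterlim_comp _ _ _ _ _ _ _ _ Hf
                      (filterlim_scal_r (V := R_NormedModule) c a)).
Qed.

Lemma filterlim_Rminus {T : Type} {F : (T -> Prop) -> Prop} {FF : Filter F}
  (f g : T -> R) (a b : R) :
  filterlim f F (locally a) -> filterlim g F (locally b) ->
  filterlim (fun t => f t - g t) F (locally (a - b)).
Proof.
  intros Hf Hg; apply filterlim_Rplus; [exact Hf|].
  exact (filterlim_comp _ _ _ _ _ _ _ _ Hg (filterlim_opp (V := R_NormedModule) b)).
Qed.

Lemma filterlim_ge_0 {T : Type} {F : (T -> Prop) -> Prop} {FF : ProperFilter F}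
  (f : T -> R) (l : R) :
  F (fun t => 0 <= f t) -> filterlim f F (locally l) -> 0 <= l.
Proof.
  intros HF Hf; exact (filterlim_le (fun _ => 0) f (Finite 0) (Finite l) HF
                         (filterlim_const 0) Hf).
Qed.

Lemma ball_R_bounds (t u : R) (eps : posreal) :
  ball t eps u -> t - eps < u < t + eps.
Proof.
  intros H; change (Rabs (u - t) < eps) in H; apply Rabs_def2 in H; lra.
Qed.

(** For [t <= 0] the conventions [ln t = 0] and [/ 0 = 0] give the value 0, which is also the limit
    of the quotient at 0 from the right. Hence continuity holds at 0 too. *)
Lemma continuous_inv_ln (t : R) : t <> 1 -> continuous (fun t => 1 / ln t) t.
Proof.
  intros Ht.
  assert (Hneg : forall u, u <= 0 -> 1 / ln u = 0).
  { intros u Hu; unfold ln; destruct (Rlt_dec 0 u); [exfalso; lra|].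
    unfold Rdiv; rewrite Rinv_0; ring. }
  destruct (Rtotal_order t 0) as [H|[->|H]].
  - apply continuous_ext_loc with (fun _ => 0).
    + exists (mkposreal (- t) ltac:(lra)); intros u Hu; symmetry; apply Hneg.
      apply ball_R_bounds in Hu; simpl in Hu; lra.
    + apply continuous_const.
  - apply filterlim_locally; intros eps.
    rewrite (Hneg 0) by lra.
    exists (mkposreal (exp (- (1 / eps))) (exp_pos _)); intros u Hu.
    apply ball_R_bounds in Hu; simpl in Hu.
    change (Rabs (1 / ln u - 0) < eps); rewrite Rminus_0_r.
    pose proof (cond_pos eps).
    assert (0 < 1 / eps) by (apply Rdiv_lt_0_compat; lra).
    destruct (Rle_dec u 0); [rewrite Hneg, Rabs_R0; lra|].
    assert (Hln : ln u < - (1 / eps)).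
    { rewrite <- (ln_exp (- (1 / eps))); apply ln_increasing; lra. }
    unfold Rdiv; rewrite Rmult_1_l, Rabs_inv, Rabs_left by lra.
    replace (pos eps) with (/ (1 / eps)) by (field; lra).
    apply Rinv_lt_contravar; [apply Rmult_lt_0_compat|]; lra.
  - apply (ex_derive_continuous (fun t => 1 / ln t)); auto_derive.
    split; [exact H | split; [|trivial]].
    apply ln_neq_0; lra.
Qed.

Definition same_side (a b : R) : Prop := (a < 1 /\ b < 1) \/ (1 < a /\ 1 < b).

Lemma ex_RInt_inv_ln (a b : R) : same_side a b -> ex_RInt (fun t => 1 / ln t) a b.
Proof.
  intros Hab; apply (@ex_RInt_continuous R_CompleteNormedModule); intros z Hz.
  apply continuous_inv_ln.
  revert Hz; unfold Rmin, Rmax; destruct Hab; destruct (Rle_dec a b); lra.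
Qed.

Lemma same_side_locally (a b : R) : same_side a b -> locally b (same_side a).
Proof.
  intros [[Ha Hb]|[Ha Hb]].
  - apply filter_imp with (fun t => t < 1); [left; lra | exact (open_lt 1 b Hb)].
  - apply filter_imp with (fun t => 1 < t); [right; lra | exact (open_gt 1 b Hb)].
Qed.

Lemma is_derive_RInt_inv_ln (a b : R) : same_side a b ->
  is_derive (fun t => RInt (fun t => 1 / ln t) a t) b (1 / ln b).
Proof.
  intros Hab; apply (is_derive_RInt (fun t => 1 / ln t) _ a).
  - apply filter_imp with (same_side a); [|apply same_side_locally, Hab].
    intros t Ht; apply (@RInt_correct R_CompleteNormedModule), ex_RInt_inv_ln, Ht.
  - apply continuous_inv_ln; destruct Hab; lra.
Qed.

Lemma continuous_RInt_inv_ln_r (a b : R) : same_side a b ->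
  continuous (fun t => RInt (fun t => 1 / ln t) a t) b.
Proof.
  intros Hab; apply (ex_derive_continuous (fun t => RInt (fun t => 1 / ln t) a t)).
  eexists; apply is_derive_RInt_inv_ln, Hab.
Qed.

Lemma continuous_RInt_inv_ln_l (a b : R) : same_side a b ->
  continuous (fun t => RInt (fun t => 1 / ln t) t b) a.
Proof.
  intros Hab; apply (ex_derive_continuous (fun t => RInt (fun t => 1 / ln t) t b)).
  exists (opp (1 / ln a)); apply (is_derive_RInt' (fun t => 1 / ln t) _ a b).
  - apply filter_imp with (same_side b).
    + intros t Ht; apply (@RInt_correct R_CompleteNormedModule), ex_RInt_inv_ln.
      destruct Ht; [left | right]; lra.
    + apply same_side_locally; destruct Hab; [left | right]; lra.
  - apply continuous_inv_ln; destruct Hab; lra.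
Qed.

(* [c] is [1] or [-1], so that one statement serves both directions. *)
Lemma RInt_inv_ln_compare (c : R) (F dF : R -> R) (a b : R) :
  a <= b -> same_side a b ->
  (forall t, a <= t <= b -> is_derive F t (dF t)) ->
  (forall t, a <= t <= b -> 0 <= c * (1 / ln t - dF t)) ->
  0 <= c * (RInt (fun t => 1 / ln t) a b - (F b - F a)).
Proof.
  intros Hab Hs HF Hc.
  set (D := fun t => c * (RInt (fun t => 1 / ln t) a t - (F t - F a))).
  assert (D0 : D a = 0).
  { unfold D; rewrite RInt_point; unfold zero; simpl; ring. }
  rewrite <- D0; change (D a <= D b).
  apply (derive_nonneg_le D (fun t => c * (1 / ln t - dF t))); trivial.
  intros t Ht; apply (is_derive_scal (fun t => RInt (fun t => 1 / ln t) a t - (F t - F a))).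
  apply (is_derive_minus (V := R_NormedModule)).
  - apply is_derive_RInt_inv_ln; destruct Hs; [left | right]; lra.
  - rewrite <- (Rminus_0_r (dF t)).
    apply (is_derive_minus (V := R_NormedModule) F (fun _ => F a)); [apply HF, Ht|].
    apply (is_derive_const (V := R_NormedModule)).
Qed.

(** Invert ln u < u - 1 at u = t and at u = 1/t; each inversion stays on one side of 0. *)
Lemma inv_ln_bounds (t : R) : 0 < t -> t <> 1 ->
  / (t - 1) <= 1 / ln t <= / (t - 1) + 1.
Proof.
  intros Ht H1.
  assert (Hu : forall u, 0 < u -> u <> 1 -> ln u < u - 1).
  { intros u Hu Hu1.
    apply exp_lt_inv; rewrite exp_ln by lra.
    pose proof (exp_ineq1 (u - 1)); lra. }
  pose proof (Hu t Ht H1) as Hlt.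
  assert (Hi : / t <> 1) by (intros Hi; apply H1; rewrite <- (Rinv_inv t), Hi; field).
  pose proof (Hu (/ t) ltac:(apply Rinv_0_lt_compat, Ht) Hi) as Hgt.
  rewrite ln_Rinv in Hgt by lra.
  assert (Hz : ln t <> 0) by (apply ln_neq_0; assumption).
  set (l := ln t) in *; clearbody l.
  replace (/ (t - 1) + 1) with (/ (1 - / t)) by (field; lra).
  unfold Rdiv; rewrite Rmult_1_l.
  destruct (Rlt_dec 1 t) as [Hc|Hc].
  - assert (/ t < 1) by (rewrite <- Rinv_1; apply Rinv_lt_contravar; lra).
    split; apply Rinv_le_contravar; lra.
  - assert (1 < / t) by (rewrite <- Rinv_1; apply Rinv_lt_contravar; lra).
    split; apply Ropp_le_cancel; rewrite <- !Rinv_opp; apply Rinv_le_contravar; lra.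
Qed.

(** On each side of 1, [1 / ln t] exceeds [/ (t - 1)] by at most 1. The logarithms from [/ (t - 1)]
    cancel between the two sides, leaving an error of at most k - h from each. *)
Lemma li_truncated_diff (x h k : R) : 1 < x -> 0 < h <= k -> k < 1 ->
  0 <= li_truncated x h - li_truncated x k <= 2 * (k - h).
Proof.
  intros Hx Hh Hk; unfold li_truncated.
  set (f := fun t => 1 / ln t).
  assert (E1 : RInt f 0 (1 - h) = RInt f 0 (1 - k) + RInt f (1 - k) (1 - h)).
  { symmetry; apply (RInt_Chasles (V := R_CompleteNormedModule));
      apply ex_RInt_inv_ln; left; lra. }
  assert (E2 : RInt f (1 + h) x = RInt f (1 + h) (1 + k) + RInt f (1 + k) x).
  { symmetry; apply (RInt_Chasles (V := R_CompleteNormedModule));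
      apply ex_RInt_inv_ln; right; lra. }
  rewrite E1, E2; clear E1 E2.
  assert (L1 : 0 <= 1 * (RInt f (1 - k) (1 - h) - (ln (1 - (1 - h)) - ln (1 - (1 - k))))).
  { apply (RInt_inv_ln_compare 1 (fun t => ln (1 - t)) (fun t => / (t - 1)));
      [lra | left; lra | |].
    - intros t Ht; auto_derive; [lra | field; lra].
    - intros t Ht; pose proof (inv_ln_bounds t); lra. }
  assert (U1 : 0 <= -1 * (RInt f (1 - k) (1 - h)
            - ((ln (1 - (1 - h)) + (1 - h)) - (ln (1 - (1 - k)) + (1 - k))))).
  { apply (RInt_inv_ln_compare (-1) (fun t => ln (1 - t) + t) (fun t => / (t - 1) + 1));
      [lra | left; lra | |].
    - intros t Ht; auto_derive; [lra | field; lra].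
    - intros t Ht; pose proof (inv_ln_bounds t); lra. }
  assert (L2 : 0 <= 1 * (RInt f (1 + h) (1 + k) - (ln (1 + k - 1) - ln (1 + h - 1)))).
  { apply (RInt_inv_ln_compare 1 (fun t => ln (t - 1)) (fun t => / (t - 1)));
      [lra | right; lra | |].
    - intros t Ht; auto_derive; [lra | field; lra].
    - intros t Ht; pose proof (inv_ln_bounds t); lra. }
  assert (U2 : 0 <= -1 * (RInt f (1 + h) (1 + k)
            - ((ln (1 + k - 1) + (1 + k)) - (ln (1 + h - 1) + (1 + h))))).
  { apply (RInt_inv_ln_compare (-1) (fun t => ln (t - 1) + t) (fun t => / (t - 1) + 1));
      [lra | right; lra | |].
    - intros t Ht; auto_derive; [lra | field; lra].
    - intros t Ht; pose proof (inv_ln_bounds t); lra. }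
  replace (1 - (1 - h)) with h in * by ring.
  replace (1 - (1 - k)) with k in * by ring.
  replace (1 + k - 1) with k in * by ring.
  replace (1 + h - 1) with h in * by ring.
  lra.
Qed.

Lemma at_right_interval (a b : R) : a < b -> at_right a (fun t => a < t < b).
Proof.
  intros Hab; exists (mkposreal (b - a) ltac:(lra)); intros t Ht Hat.
  apply ball_R_bounds in Ht; simpl in Ht; lra.
Qed.

Lemma at_left_interval (a b : R) : a < b -> at_left b (fun t => a < t < b).
Proof.
  intros Hab; exists (mkposreal (b - a) ltac:(lra)); intros t Ht Hat.
  apply ball_R_bounds in Ht; simpl in Ht; lra.
Qed.

Lemma li_correct (x : R) : 1 < x ->
  filterlim (li_truncated x) (at_right 0) (locally (li x)).
Proof.
  intros Hx.
  assert (Hex : exists l : R, filterlim (li_truncated x) (at_right 0) (locally l)).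
  { apply (filterlim_locally_cauchy (U := R_CompleteSpace)); intros eps.
    set (d := Rmin 1 (eps / 2)).
    assert (Hd : 0 < d <= 1 /\ 2 * d <= eps).
    { pose proof (cond_pos eps); unfold d, Rmin; destruct (Rle_dec 1 (eps / 2)); lra. }
    exists (fun t => 0 < t < d); split; [apply at_right_interval; lra|].
    intros u v Hu Hv.
    change (Rabs (li_truncated x v - li_truncated x u) < eps).
    apply Rabs_def1; destruct (Rle_dec u v).
    - pose proof (li_truncated_diff x u v); lra.
    - pose proof (li_truncated_diff x v u); lra.
    - pose proof (li_truncated_diff x u v); lra.
    - pose proof (li_truncated_diff x v u); lra. }
  destruct Hex as [l Hl].
  replace (li x) with l; [exact Hl | symmetry].
  exact (iota_filterlim_locally (V := R_CompleteNormedModule) (li_truncated x) l Hl).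
Qed.

Lemma filterlim_continuous_within (f : R -> R) (D : R -> Prop) (t : R) :
  continuous f t -> filterlim f (within D (locally t)) (locally (f t)).
Proof.
  intros Hf; eapply filterlim_filter_le_1; [|exact Hf].
  apply filter_le_within.
Qed.

(** Compare on compact intervals inside (0, 1) and (1, x), then pass to the limit at 0, at x, and
    symmetrically at 1. Limits replace endpoint values because the [W] used later involves [phi],
    which tends to infinity at both ends. *)
Lemma li_compare (c x w0 w1 : R) (W dW : R -> R) : 1 < x ->
  (forall t, 0 < t < x -> t <> 1 -> is_derive W t (dW t)) ->
  (forall t, 0 < t < x -> t <> 1 -> 0 <= c * (1 / ln t - dW t)) ->
  filterlim W (at_right 0) (locally w0) ->
  filterlim W (at_left x) (locally w1) ->
  filterlim (fun h => W (1 - h) - W (1 + h)) (at_right 0) (locally 0) ->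
  0 <= c * (li x - (w1 - w0)).
Proof.
  intros Hx HW Hc H0 H1 Hpv.
  set (f := fun t => 1 / ln t).
  assert (HL : forall h, 0 < h < 1 ->
    0 <= c * (RInt f 0 (1 - h) - (W (1 - h) - w0))).
  { intros h Hh.
    apply (filterlim_ge_0 (F := at_right 0)
      (fun a => c * (RInt f a (1 - h) - (W (1 - h) - W a)))).
    - apply filter_imp with (fun a => 0 < a < 1 - h); [|apply at_right_interval; lra].
      intros a Ha; apply (RInt_inv_ln_compare c W dW); [lra | left; lra | |];
        intros t Ht; [apply HW | apply Hc]; lra.
    - apply filterlim_Rscal, filterlim_Rminus.
      + apply (filterlim_continuous_within (fun a => RInt f a (1 - h))).
        apply continuous_RInt_inv_ln_l; left; lra.
      + apply filterlim_Rminus; [apply filterlim_const | exact H0]. }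
  assert (HR : forall h, 0 < h < x - 1 ->
    0 <= c * (RInt f (1 + h) x - (w1 - W (1 + h)))).
  { intros h Hh.
    apply (filterlim_ge_0 (F := at_left x)
      (fun b => c * (RInt f (1 + h) b - (W b - W (1 + h))))).
    - apply filter_imp with (fun b => 1 + h < b < x); [|apply at_left_interval; lra].
      intros b Hb; apply (RInt_inv_ln_compare c W dW); [lra | right; lra | |];
        intros t Ht; [apply HW | apply Hc]; lra.
    - apply filterlim_Rscal, filterlim_Rminus.
      + apply (filterlim_continuous_within (fun b => RInt f (1 + h) b)).
        apply continuous_RInt_inv_ln_r; right; lra.
      + apply filterlim_Rminus; [exact H1 | apply filterlim_const]. }
  replace (w1 - w0) with (w1 - w0 + 0) by ring.
  apply (filterlim_ge_0 (F := at_right 0)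
    (fun h => c * (li_truncated x h - (w1 - w0 + (W (1 - h) - W (1 + h)))))).
  - apply filter_imp with (fun h => 0 < h < Rmin 1 (x - 1)).
    + intros h Hh.
      assert (h < 1 /\ h < x - 1) by (revert Hh; unfold Rmin; destruct (Rle_dec 1 (x - 1)); lra).
      specialize (HL h ltac:(lra)); specialize (HR h ltac:(lra)).
      unfold li_truncated; fold f. lra.
    + apply at_right_interval, Rmin_pos; lra.
  - apply filterlim_Rscal, filterlim_Rminus; [apply li_correct, Hx|].
    apply filterlim_Rplus; [apply filterlim_const | exact Hpv].
Qed.

(** * Antiderivatives of the weighted integrands *)

(* In the variable s = - ln t / N the point t = 1 becomes s = 0. *)
Definition scaled_log (N t : R) : R := - ln t / N.

Lemma is_derive_scaled_log (N t : R) : 0 < t -> 0 < N ->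
  is_derive (scaled_log N) t (- / (N * t)).
Proof.
  intros Ht HN; unfold scaled_log; auto_derive; [exact Ht | field; lra].
Qed.

(** With t = exp (- N s), this is N times the incomplete gamma integral of (1 + u)^m exp (- N u)
    over u >= s; the recursion is integration by parts. *)
Fixpoint gamma_prim (N : R) (m : nat) (t : R) : R :=
  match m with
  | O => t
  | S p => t * (1 + scaled_log N t) ^ S p + INR (S p) / N * gamma_prim N p t
  end.

Lemma is_derive_gamma_prim (N : R) (m : nat) (t : R) : 0 < t -> 0 < N ->
  is_derive (gamma_prim N m) t ((1 + scaled_log N t) ^ m).
Proof.
  intros Ht HN; induction m as [|p IH].
  - simpl; apply (is_derive_id (K := R_AbsRing)).
  - simpl gamma_prim.
    replace ((1 + scaled_log N t) ^ S p) with
      (((1 + scaled_log N t) ^ S p - INR (S p) / N * (1 + scaled_log N t) ^ p)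
       + INR (S p) / N * (1 + scaled_log N t) ^ p) by ring.
    apply (is_derive_plus (V := R_NormedModule)
      (fun t => t * (1 + scaled_log N t) ^ S p) (fun t => INR (S p) / N * gamma_prim N p t)).
    + unfold scaled_log. auto_derive; [exact Ht|].
      change (match p with O => 1 | S _ => INR p + 1 end) with (INR (S p)).
      change ((1 + - ln t / N) ^ S p) with ((1 + - ln t / N) * (1 + - ln t / N) ^ p).
      unfold Rdiv; generalize ((1 + - ln t * / N) ^ p); intros X; field; lra.
    + apply (is_derive_scal (gamma_prim N p)), IH.
Qed.

Lemma is_lim_exp_mul_pow (N a : R) (m : nat) : 0 < N -> 0 < a ->
  is_lim (fun v => exp (a * v) * (1 - v / N) ^ m) m_infty 0.
Proof.
  intros HN; revert a.
  assert (Hb : forall a, 0 < a -> is_lim (fun v => a * v) m_infty m_infty).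
  { intros a Ha. replace m_infty with (Rbar_mult a m_infty) at 2.
    - apply is_lim_scal_l, is_lim_id.
    - simpl; destruct (Rle_dec 0 a); [|lra].
      destruct (Rle_lt_or_eq_dec 0 a r); [reflexivity | lra]. }
  assert (He : forall a, 0 < a -> is_lim (fun v => exp (a * v)) m_infty 0).
  { intros a Ha; apply (is_lim_comp exp (fun v => a * v) m_infty 0 m_infty);
      [apply is_lim_exp_m | apply Hb, Ha | exists 0; discriminate]. }
  induction m as [|m IH]; intros a Ha.
  - apply is_lim_ext with (fun v => exp (a * v)); [intros v; simpl; ring | apply He, Ha].
  (* Half of the exponential absorbs the new linear factor; the other half feeds the induction
     hypothesis, which therefore covers every rate [a]. *)
  - apply is_lim_ext with (fun v =>
      (exp (a / 2 * v) - / (a / 2 * N) * (a / 2 * v * exp (a / 2 * v)))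
      * (exp (a / 2 * v) * (1 - v / N) ^ m)).
    { intros v. replace (a * v) with (a / 2 * v + a / 2 * v) by field.
      rewrite exp_plus; simpl; field; lra. }
    replace (Finite 0) with (Finite ((0 - / (a / 2 * N) * 0) * 0)) by (f_equal; ring).
    apply (is_lim_mult _ _ m_infty (Finite (0 - / (a / 2 * N) * 0)) (Finite 0));
      [| apply IH; lra | exact I].
    apply is_lim_minus'; [apply He; lra|].
    apply (is_lim_scal_l _ _ m_infty (Finite 0)).
    apply (is_lim_comp (fun w => w * exp w) (fun v => a / 2 * v) m_infty 0 m_infty);
      [apply is_lim_mul_exp_m | apply Hb; lra | exists 0; discriminate].
Qed.

Lemma filterlim_gamma_prim_0 (N : R) (m : nat) : 0 < N ->
  filterlim (gamma_prim N m) (at_right 0) (locally 0).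
Proof.
  intros HN; induction m as [|p IH].
  - simpl; apply (filterlim_continuous_within (fun t => t)), continuous_id.
  - simpl gamma_prim.
    replace 0 with (0 + INR (S p) / N * 0) at 2 by ring.
    apply filterlim_Rplus; [|apply filterlim_Rscal, IH].
    apply filterlim_ext_loc with (fun t => exp (1 * ln t) * (1 - ln t / N) ^ S p).
    + apply filter_imp with (fun t => 0 < t < 1); [|apply at_right_interval; lra].
      intros t Ht; rewrite Rmult_1_l, exp_ln by lra; unfold scaled_log.
      replace (1 - ln t / N) with (1 + - ln t / N) by (field; lra); reflexivity.
    + apply (filterlim_comp _ _ _ ln (fun v => exp (1 * v) * (1 - v / N) ^ S p)
               _ (Rbar_locally m_infty)); [apply is_lim_ln_0|].
      apply (is_lim_exp_mul_pow N 1 (S p)); lra.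
Qed.

(** At t = exp N the base 1 + s is 0, so every boundary term drops out and only the product of the
    factors k/N survives. *)
Lemma gamma_prim_end (N : R) (m : nat) : 0 < N ->
  gamma_prim N m (exp N) = exp N * INR (fact m) / N ^ m.
Proof.
  intros HN; induction m as [|p IH].
  - simpl; field.
  - change (gamma_prim N (S p) (exp N)) with
      (exp N * (1 + scaled_log N (exp N)) ^ S p + INR (S p) / N * gamma_prim N p (exp N)).
    rewrite IH; unfold scaled_log; rewrite ln_exp.
    rewrite fact_simpl, mult_INR.
    replace (1 + - N / N) with 0 by (field; lra).
    rewrite (pow_i (S p)) by lia. simpl (N ^ S p).
    field; repeat split; try apply pow_nonzero; lra.
Qed.

Lemma filterlim_derive_within (f : R -> R) (D : R -> Prop) (t l : R) :
  is_derive f t l -> filterlim f (within D (locally t)) (locally (f t)).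
Proof.
  intros Hf; apply filterlim_continuous_within, (ex_derive_continuous f).
  exists l; exact Hf.
Qed.

(** Up to a constant this is - E_1 (N y) / 2, with E_1 the exponential integral. Composed with [phi]
    it integrates the weighted kernel phi' / (2 phi). *)
Definition exp_int (N y : R) : R := RInt (fun z => exp (- N * z) / (2 * z)) 1 y.

Lemma is_derive_exp_int (N y : R) : 0 < y ->
  is_derive (exp_int N) y (exp (- N * y) / (2 * y)).
Proof.
  intros Hy.
  assert (Hc : forall z, 0 < z -> continuous (fun z => exp (- N * z) / (2 * z)) z).
  { intros z Hz; apply (ex_derive_continuous (fun z => exp (- N * z) / (2 * z))).
    auto_derive; lra. }
  apply (is_derive_RInt (fun z => exp (- N * z) / (2 * z)) _ 1); [|apply Hc, Hy].
  apply filter_imp with (fun t => 0 < t); [|exact (open_gt 0 y Hy)].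
  intros t Ht; apply (@RInt_correct R_CompleteNormedModule).
  apply (@ex_RInt_continuous R_CompleteNormedModule); intros z Hz; apply Hc.
  revert Hz; unfold Rmin; destruct (Rle_dec 1 t); lra.
Qed.

Lemma exp_int_incr_ln (N a b : R) : 0 < N -> 0 < a <= b ->
  0 <= exp_int N b - exp_int N a <= (ln b - ln a) / 2.
Proof.
  intros HN Hab; split.
  - enough (exp_int N a <= exp_int N b) by lra.
    apply (derive_nonneg_le (exp_int N) (fun y => exp (- N * y) / (2 * y))); [lra| |].
    + intros t Ht; apply is_derive_exp_int; lra.
    + intros t Ht; pose proof (exp_pos (- N * t)).
      left; apply Rdiv_lt_0_compat; lra.
  - enough (ln a / 2 - exp_int N a <= ln b / 2 - exp_int N b) by lra.
    apply (derive_nonneg_le (fun y => ln y / 2 - exp_int N y)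
      (fun y => / (2 * y) - exp (- N * y) / (2 * y))); [lra| |].
    + intros t Ht; apply (is_derive_minus (V := R_NormedModule) (fun y => ln y / 2));
        [|apply is_derive_exp_int; lra].
      auto_derive; [lra | field; lra].
    + intros t Ht.
      assert (0 < / (2 * t)) by (apply Rinv_0_lt_compat; lra).
      assert (exp (- N * t) <= exp 0) by (apply exp_le_compat; nra).
      rewrite exp_0 in *; unfold Rdiv; nra.
Qed.

(** The bound sees only the ratio of the arguments, so it survives when both tend to 0, where
    [exp_int] diverges. *)
Lemma Rabs_exp_int_sub_ln (N a b : R) : 0 < N -> 0 < a -> 0 < b ->
  Rabs (exp_int N a - exp_int N b) <= Rabs (ln (a / b)) / 2.
Proof.
  intros HN Ha Hb.
  assert (Hln : ln (a / b) = ln a - ln b).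
  { unfold Rdiv; rewrite ln_mult, ln_Rinv by positivity; ring. }
  rewrite Hln.
  destruct (Rle_dec a b).
  - pose proof (exp_int_incr_ln N a b HN ltac:(lra)).
    rewrite !Rabs_left1 by lra; lra.
  - pose proof (exp_int_incr_ln N b a HN ltac:(lra)).
    rewrite !Rabs_pos_eq by lra; lra.
Qed.

Lemma exp_int_tail (N a b : R) : 1 <= N -> 1 <= a <= b ->
  0 <= exp_int N b - exp_int N a <= exp (- a).
Proof.
  intros HN Hab; split; [apply exp_int_incr_ln; lra|].
  enough (- exp (- a) - exp_int N a <= - exp (- b) - exp_int N b)
    by (pose proof (exp_pos (- b)); lra).
  apply (derive_nonneg_le (fun y => - exp (- y) - exp_int N y)
    (fun y => exp (- y) - exp (- N * y) / (2 * y))); [lra| |].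
  - intros t Ht; apply (is_derive_minus (V := R_NormedModule) (fun y => - exp (- y)));
      [|apply is_derive_exp_int; lra].
    auto_derive; [trivial | ring].
  - intros t Ht.
    assert (exp (- N * t) <= exp (- t)) by (apply exp_le_compat; nra).
    pose proof (exp_pos (- N * t)).
    assert (/ (2 * t) <= / 1) by (apply Rinv_le_contravar; lra).
    rewrite Rinv_1 in *; unfold Rdiv; nra.
Qed.

Lemma exp_int_lim (N : R) : 1 <= N ->
  exists L : R, filterlim (exp_int N) (Rbar_locally p_infty) (locally L).
Proof.
  intros HN; apply (filterlim_locally_cauchy (U := R_CompleteSpace)); intros eps.
  pose proof (cond_pos eps).
  set (M := Rmax 1 (- ln eps)).
  assert (HM : 1 <= M /\ - ln eps <= M) by (split; [apply Rmax_l | apply Rmax_r]).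
  assert (Htail : forall u, M < u -> exp (- u) < eps).
  { intros u Hu; rewrite <- (exp_ln eps) by lra; apply exp_increasing; lra. }
  exists (fun y => M < y); split; [exists M; trivial|].
  intros u v Hu Hv.
  change (Rabs (exp_int N v - exp_int N u) < eps).
  destruct (Rle_dec u v).
  - pose proof (exp_int_tail N u v HN ltac:(lra)); specialize (Htail u Hu).
    rewrite Rabs_pos_eq; lra.
  - pose proof (exp_int_tail N v u HN ltac:(lra)); specialize (Htail v Hv).
    rewrite Rabs_left1; lra.
Qed.

(** * Behaviour of phi at the ends and at the singularity *)

Lemma filterlim_phi_at_0 (N : R) : 0 < N ->
  filterlim (fun t => phi (scaled_log N t)) (at_right 0) (Rbar_locally p_infty).
Proof.
  intros HN P [M HM].
  set (K := Rmax 0 (2 * M + 2)).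
  assert (HK : 0 <= K /\ 2 * M + 2 <= K) by (split; [apply Rmax_l | apply Rmax_r]).
  unfold filtermap; apply (filter_imp (fun t => 0 < t < exp (- (N * K))));
    [|apply at_right_interval, exp_pos].
  intros t Ht; apply HM.
  assert (Hs : K < scaled_log N t).
  { unfold scaled_log; apply Rmult_lt_reg_r with N; [exact HN|].
    replace (- ln t / N * N) with (- ln t) by (field; lra).
    assert (ln t < - (N * K)) by (rewrite <- ln_exp; apply ln_increasing; lra). lra. }
  set (s := scaled_log N t) in *.
  assert (ln (1 + s) <= (s + 1) / 2).
  { rewrite <- (ln_exp ((s + 1) / 2)); apply ln_le; [lra|].
    replace ((s + 1) / 2) with ((s - 1) / 2 + 1) by field.
    rewrite exp_plus. pose proof (exp_ineq1_le ((s - 1) / 2)).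
    pose proof (exp_ineq1_le 1). nra. }
  unfold phi; lra.
Qed.

Lemma filterlim_phi_at_end (N : R) : 0 < N ->
  filterlim (fun t => phi (scaled_log N t)) (at_left (exp N)) (Rbar_locally p_infty).
Proof.
  intros HN P [M HM].
  (* This range makes 1 + s smaller than exp (- M - 1), so - ln (1 + s) exceeds M + 1 while s stays
     above -1. *)
  unfold filtermap; apply (filter_imp (fun t => exp (N * (1 - exp (- M - 1))) < t < exp N)).
  - intros t Ht; apply HM.
    assert (0 < t) by (eapply Rlt_trans; [apply exp_pos | apply Ht]).
    assert (ln t < N) by (rewrite <- (ln_exp N); apply ln_increasing; lra).
    assert (N * (1 - exp (- M - 1)) < ln t).
    { rewrite <- (ln_exp (N * (1 - exp (- M - 1)))); apply ln_increasing; [apply exp_pos | lra]. }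
    set (s := scaled_log N t).
    assert (Hs : ln t = - N * s) by (unfold s, scaled_log; field; lra).
    assert (-1 < s < -1 + exp (- M - 1)) by (split; nra).
    assert (ln (1 + s) < - M - 1).
    { rewrite <- (ln_exp (- M - 1)); apply ln_increasing; lra. }
    unfold phi; lra.
  - apply at_left_interval, exp_increasing.
    pose proof (exp_pos (- M - 1)); nra.
Qed.

(** Squeezed by the two global bounds, whose polynomials both differ from 1 by at most |s| near
    0. *)
Lemma is_lim_phi_ratio : is_lim (fun s => s ^ 2 / (2 * phi s)) 0 1.
Proof.
  apply filterlim_locally; intros eps.
  pose proof (cond_pos eps).
  set (d := Rmin (1 / 2) eps).
  assert (Hd : 0 < d <= 1 / 2 /\ d <= eps).
  { unfold d, Rmin; destruct (Rle_dec (1 / 2) eps); lra. }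
  exists (mkposreal d (proj1 (proj1 Hd))); intros s Hs Hs0.
  apply ball_R_bounds in Hs; simpl in Hs.
  change (Rabs (s ^ 2 / (2 * phi s) - 1) < eps).
  pose proof (Qpoly_upper s ltac:(lra) Hs0) as Hu.
  pose proof (Qpoly_lower s ltac:(lra) Hs0) as Hl.
  pose proof (phi_pos s ltac:(lra) Hs0) as Hphi.
  replace (s ^ 2 / (2 * phi s)) with (s * (s / (2 * phi s))) by (field; lra).
  set (r := s / (2 * phi s)) in *.
  assert (Hm : forall q d, s * (Qpoly q d s / s) = Qpoly q d s)
    by (intros; field; exact Hs0).
  pose proof (Hm (1 / 60) (-1)) as Hmu; pose proof (Hm (1 / 30) 1) as Hml; clear Hm.
  assert (0 <= s ^ 2 <= 1 / 4) by nra.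
  assert (0 <= s ^ 4 <= 1 / 16) by (replace (s ^ 4) with (s ^ 2 * s ^ 2) by ring; nra).
  assert (Hb : forall q d, 0 <= q <= 1 / 30 -> -1 <= d <= 1 ->
            Rabs (Qpoly q d s - 1) <= Rabs s).
  { intros q d' Hq Hd'.
    replace (Qpoly q d' s - 1)
      with (s * (2 / 3 - s / 18 + q * s ^ 2 + d' * s ^ 4)) by (unfold Qpoly; field).
    rewrite Rabs_mult. rewrite <- (Rmult_1_r (Rabs s)) at 2.
    apply Rmult_le_compat_l; [apply Rabs_pos|].
    apply Rabs_le; split; nra. }
  pose proof (Hb (1 / 60) (-1) ltac:(lra) ltac:(lra)) as Bu.
  pose proof (Hb (1 / 30) 1 ltac:(lra) ltac:(lra)) as Bl.
  assert (Habs : Rabs s < eps) by (apply Rabs_def1; lra).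
  pose proof (Rle_lt_trans _ _ _ Bu Habs) as Cu; apply Rabs_def2 in Cu.
  pose proof (Rle_lt_trans _ _ _ Bl Habs) as Cl; apply Rabs_def2 in Cl.
  apply Rabs_def1; destruct (Rle_dec 0 s); nra.
Qed.

(** Here s is asymptotic to - h / N and phi s to s^2 / 2. The two-sided limit expresses the
    leading-order symmetry about t = 1. *)
Lemma is_lim_phi_scaled_log (N : R) : 0 < N ->
  is_lim (fun h => phi (scaled_log N (1 + h)) / h ^ 2) 0 (/ (2 * N ^ 2)).
Proof.
  intros HN.
  set (g := fun h => scaled_log N (1 + h)).
  assert (Hnz : Rbar_locally' 0 (fun h => h <> 0 /\ -1 < g h /\ g h <> 0)).
  { exists (mkposreal _ (Rmin_pos _ _ Rlt_0_1 HN)); intros h Hh H0.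
    apply ball_R_bounds in Hh; simpl in Hh.
    assert (-1 < h < N) by (revert Hh; unfold Rmin; destruct (Rle_dec 1 N); lra).
    assert (HgN : N * g h = - ln (1 + h)) by (unfold g, scaled_log; field; lra).
    split; [exact H0|]. split.
    { assert (ln (1 + h) < N); [|nra].
      rewrite <- (ln_exp N); apply ln_increasing; [lra|].
      pose proof (exp_ineq1 N); lra. }
    intros Hg.
    apply (ln_neq_0 (1 + h)); [lra | lra | rewrite Hg in HgN; lra]. }
  assert (Hg : is_lim g 0 0).
  { replace (Finite 0) with (Finite (g 0)) at 2.
    - apply is_lim_continuity, continuity_pt_filterlim, (ex_derive_continuous g).
      unfold g, scaled_log; auto_derive; lra.
    - unfold g, scaled_log; rewrite Rplus_0_r, ln_1; f_equal; field; lra. }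
  assert (Hgh : is_lim (fun h => g h / h) 0 (- / N)).
  { apply is_lim_ext with (fun h => - / N * (ln (1 + h) / h)).
    - intros h; unfold g, scaled_log, Rdiv; ring.
    - replace (Finite (- / N)) with (Rbar_mult (- / N) 1) by (simpl; f_equal; ring).
      apply is_lim_scal_l, is_lim_div_ln1p_0. }
  assert (Hrho : is_lim (fun h => (g h) ^ 2 / (2 * phi (g h))) 0 1).
  { apply (is_lim_comp (fun s => s ^ 2 / (2 * phi s)) g 0 1 0);
      [apply is_lim_phi_ratio | exact Hg|].
    apply filter_imp with (2 := Hnz); intros h (_ & _ & Hh).
    apply Rbar_finite_neq, Hh. }
  assert (Hq : is_lim (fun h => / 2 * ((g h / h * (g h / h)) / ((g h) ^ 2 / (2 * phi (g h)))))
                 0 (Rbar_mult (/ 2) (Rbar_div (Finite (- / N * - / N)) (Finite 1)))).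
  { apply is_lim_scal_l, is_lim_div; [| exact Hrho | | exact I].
    - apply (is_lim_mult _ _ 0 (Finite (- / N)) (Finite (- / N))); try exact I; exact Hgh.
    - apply Rbar_finite_neq; lra. }
  replace (Finite (/ (2 * N ^ 2)))
    with (Rbar_mult (/ 2) (Rbar_div (Finite (- / N * - / N)) (Finite 1))).
  - apply is_lim_ext_loc with (2 := Hq).
    apply filter_imp with (2 := Hnz); intros h (H0 & H1 & Hh).
    fold (g h).
    assert (0 < phi (g h)).
    { apply phi_pos; assumption. }
    field; repeat split; lra.
  - simpl; f_equal; field; lra.
Qed.

(** * Comparison of li with its Stieltjes approximation *)

(** The two values of [phi] have ratio tending to 1, since both are asymptotic to the same multiple
    of h^2. [Rabs_exp_int_sub_ln] then forces the difference to 0. *)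
Lemma filterlim_exp_int_pv (N : R) : 0 < N ->
  filterlim (fun h => exp_int N (phi (scaled_log N (1 - h)))
                      - exp_int N (phi (scaled_log N (1 + h))))
    (at_right 0) (locally 0).
Proof.
  intros HN.
  set (psi := fun h => phi (scaled_log N (1 + h)) / h ^ 2).
  pose proof (is_lim_phi_scaled_log N HN) as Hpsi; fold psi in Hpsi.
  assert (HN2 : 0 < / (2 * N ^ 2)) by positivity.
  assert (Hpsi' : is_lim (fun h => psi (- h)) 0 (/ (2 * N ^ 2))).
  { apply (is_lim_comp psi (fun h => - h) 0 _ 0); [exact Hpsi | |].
    - replace (Finite 0) with (Rbar_opp 0) at 2 by (simpl; f_equal; ring).
      apply is_lim_opp, is_lim_id.
    - exists (mkposreal 1 Rlt_0_1); intros h _ Hh; apply Rbar_finite_neq; lra. }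
  assert (Hln : is_lim (fun h => ln (psi (- h) / psi h)) 0 0).
  { replace (Finite 0) with (Finite (ln 1)) at 2 by (rewrite ln_1; reflexivity).
    apply (filterlim_comp _ _ _ (fun h => psi (- h) / psi h) ln _ (locally 1)).
    - replace 1 with (/ (2 * N ^ 2) / / (2 * N ^ 2)) by (field; lra).
      apply (is_lim_div _ _ 0 (Finite (/ (2 * N ^ 2))) (Finite (/ (2 * N ^ 2))));
        [exact Hpsi' | exact Hpsi | apply Rbar_finite_neq; lra | exact I].
    - apply (ex_derive_continuous ln); auto_derive; lra. }
  apply filterlim_locally; intros eps.
  apply (proj1 (filterlim_locally _ _)) with (eps := eps) in Hln.
  destruct Hln as [d Hd].
  assert (Hm : 0 < Rmin d (Rmin 1 (exp N - 1))).
  { pose proof (exp_ineq1 N); pose proof (cond_pos d).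
    repeat apply Rmin_pos; lra. }
  apply filter_imp with (2 := at_right_interval 0 _ Hm); intros h Hh.
  assert (h < d /\ h < 1 /\ 1 + h < exp N) as (Hhd & Hh1 & HhN).
  { revert Hh; unfold Rmin; repeat destruct Rle_dec; lra. }
  specialize (Hd h).
  assert (Hs : forall u, 0 < u < exp N -> u <> 1 -> 0 < phi (scaled_log N u)).
  { intros u Hu Hu1.
    assert (E : N * scaled_log N u = - ln u) by (unfold scaled_log; field; lra).
    assert (ln u < N) by (rewrite <- (ln_exp N); apply ln_increasing; lra).
    apply phi_pos; [nra|].
    intros E0; rewrite E0 in E; apply (ln_neq_0 u); lra. }
  pose proof (Hs (1 - h) ltac:(lra) ltac:(lra)) as Hp1.
  pose proof (Hs (1 + h) ltac:(lra) ltac:(lra)) as Hp2.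
  assert (Hb : Rabs (ln (psi (- h) / psi h) - 0) < eps).
  { apply Hd; [|lra]. change (Rabs (h - 0) < d). rewrite Rabs_pos_eq; lra. }
  change (Rabs (exp_int N (phi (scaled_log N (1 - h)))
                - exp_int N (phi (scaled_log N (1 + h))) - 0) < eps).
  rewrite Rminus_0_r in *.
  replace (psi (- h) / psi h)
    with (phi (scaled_log N (1 - h)) / phi (scaled_log N (1 + h))) in Hb.
  - pose proof (Rabs_exp_int_sub_ln N _ _ HN Hp1 Hp2).
    pose proof (Rabs_pos (ln (phi (scaled_log N (1 - h)) / phi (scaled_log N (1 + h))))).
    lra.
  - unfold psi; change (1 + - h) with (1 - h); field; repeat split; lra.
Qed.

Lemma filterlim_pv_continuous (f : R -> R) : continuous f 1 ->
  filterlim (fun h => f (1 - h) - f (1 + h)) (at_right 0) (locally 0).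
Proof.
  intros Hf.
  replace 0 with (f 1 - f 1) at 2 by ring.
  apply filterlim_Rminus.
  - apply (filterlim_comp _ _ _ (fun h => 1 - h) f _ (locally 1)); [|exact Hf].
    replace (locally 1) with (locally (1 - 0)) by (rewrite Rminus_0_r; reflexivity).
    apply (filterlim_derive_within (fun h => 1 - h) _ 0 (-1)).
    auto_derive; [trivial | ring].
  - apply (filterlim_comp _ _ _ (fun h => 1 + h) f _ (locally 1)); [|exact Hf].
    replace (locally 1) with (locally (1 + 0)) by (rewrite Rplus_0_r; reflexivity).
    apply (filterlim_derive_within (fun h => 1 + h) _ 0 1).
    auto_derive; [trivial | ring].
Qed.

(* Antiderivative of y^p (y - Qpoly q d s) / s, where y = 1 + s: the quotient
   (y - Qpoly q d s) / s = 1/3 + s/18 - q s^2 - d s^4 is expanded in powers of y. *)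
Definition remainder_prim (q d N : R) (p : nat) (t : R) : R :=
  (5 / 18 - q - d) * gamma_prim N p t
  + (1 / 18 + 2 * q + 4 * d) * gamma_prim N (p + 1) t
  + (- q - 6 * d) * gamma_prim N (p + 2) t
  + 4 * d * gamma_prim N (p + 3) t
  - d * gamma_prim N (p + 4) t.

(** With y = 1 + s, the geometric sum gives 1 / ln t = (sum of y^k for k <= p, minus y^(p+1) / s) /
    N. This integrates the sum and the part y^p (y - Q) / s of the last term; the singular y^p Q / s
    is left to [exp_int]. *)
Definition main_prim (q d N : R) (p : nat) (t : R) : R :=
  / N * (sum_f_R0 (fun k => gamma_prim N k t) p - remainder_prim q d N p t).

Definition main_deriv (q d N : R) (p : nat) (t : R) : R :=
  let s := scaled_log N t in
  / N * (sum_f_R0 (fun k => (1 + s) ^ k) p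
         - (1 + s) ^ p * (1 / 3 + s / 18 - q * s ^ 2 - d * s ^ 4)).

Lemma is_derive_main_prim (q d N : R) (p : nat) (t : R) : 0 < t -> 0 < N ->
  is_derive (main_prim q d N p) t (main_deriv q d N p t).
Proof.
  intros Ht HN; unfold main_prim, main_deriv; cbv zeta.
  pose proof (fun m => is_derive_gamma_prim N m t Ht HN) as HG.
  set (y := 1 + scaled_log N t) in *.
  apply (is_derive_scal (fun t => sum_f_R0 (fun k => gamma_prim N k t) p
                                  - remainder_prim q d N p t)).
  apply (is_derive_minus (V := R_NormedModule)
           (fun t => sum_f_R0 (fun k => gamma_prim N k t) p)).
  - induction p as [|p IH]; [exact (HG O)|].
    exact (is_derive_plus (V := R_NormedModule) _ _ _ _ _ IH (HG (S p))).
  - unfold remainder_prim.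
    replace (y ^ p * (1 / 3 + scaled_log N t / 18 - q * scaled_log N t ^ 2
                      - d * scaled_log N t ^ 4))
      with ((5 / 18 - q - d) * y ^ p + (1 / 18 + 2 * q + 4 * d) * y ^ (p + 1)
            + (- q - 6 * d) * y ^ (p + 2) + 4 * d * y ^ (p + 3) - d * y ^ (p + 4)).
    2: { rewrite !pow_add; replace (scaled_log N t) with (y - 1) by (unfold y; ring). field. }
    repeat first
      [ apply (is_derive_minus (V := R_NormedModule))
      | apply (is_derive_plus (V := R_NormedModule))
      | apply is_derive_scal; apply HG ].
Qed.

Lemma filterlim_main_prim_0 (q d N : R) (p : nat) : 0 < N ->
  filterlim (main_prim q d N p) (at_right 0) (locally 0).
Proof.
  intros HN; unfold main_prim, remainder_prim.
  pose proof (fun m => filterlim_gamma_prim_0 N m HN) as HG.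
  replace 0 with (/ N * (0 - ((5 / 18 - q - d) * 0 + (1 / 18 + 2 * q + 4 * d) * 0
    + (- q - 6 * d) * 0 + 4 * d * 0 - d * 0))) at 2 by ring.
  apply filterlim_Rscal, filterlim_Rminus.
  - induction p as [|p IH]; [exact (HG O)|].
    replace (locally 0) with (locally (0 + 0)) by (rewrite Rplus_0_r; reflexivity).
    exact (filterlim_Rplus _ _ _ _ IH (HG (S p))).
  - repeat first [apply filterlim_Rminus | apply filterlim_Rplus
                 | apply filterlim_Rscal; apply HG].
Qed.

(** For N = p + 1 the weight y^p exp (- N s) is a gamma density up to scaling: s has mean 0, second
    moment 1/N and fourth moment 3/N^2 + 6/N^3. *)
Lemma main_prim_end (q d : R) (p : nat) : let N := INR (S p) in
  main_prim q d N p (exp N) =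
  exp N / N * sum_f_R0 (fun k => INR (fact k) / N ^ k) p
  - stirling_ratio (S p) * (1 / 3 - q / N - d * (3 / N ^ 2 + 6 / N ^ 3)).
Proof.
  intros N.
  assert (HN : 0 < N) by (apply lt_0_INR; lia).
  assert (Hsum : sum_f_R0 (fun k => gamma_prim N k (exp N)) p
                 = exp N * sum_f_R0 (fun k => INR (fact k) / N ^ k) p).
  { rewrite scal_sum; apply sum_eq; intros k _.
    rewrite gamma_prim_end by exact HN. field; apply pow_nonzero; lra. }
  assert (Hp : INR p = N - 1) by (unfold N; rewrite S_INR; ring).
  unfold main_prim, remainder_prim, stirling_ratio; rewrite Hsum, !gamma_prim_end by exact HN.
  fold N.
  replace (p + 4)%nat with (S (S (S (S p)))) by lia.
  replace (p + 3)%nat with (S (S (S p))) by lia.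
  replace (p + 2)%nat with (S (S p)) by lia.
  replace (p + 1)%nat with (S p) by lia.
  replace (S p + 1)%nat with (S (S p)) by lia.
  rewrite !fact_simpl, !mult_INR, !S_INR, Hp. simpl (N ^ S _).
  field; repeat split; try apply pow_nonzero; lra.
Qed.

Lemma stieltjes_error_compare (c q d : R) (p : nat) :
  (forall s, -1 < s -> s <> 0 -> 0 <= c * (s / (2 * phi s) - Qpoly q d s / s)) ->
  let N := INR (S p) in
  0 <= c * (stirling_ratio (S p) * (1 / 3 - q / N - d * (3 / N ^ 2 + 6 / N ^ 3))
            - stieltjes_error_exp (S p)).
Proof.
  intros HQ N.
  assert (HN : 1 <= N) by (unfold N; rewrite S_INR; pose proof (pos_INR p); lra).
  assert (Hx : 1 < exp N) by (pose proof (exp_ineq1 N); lra).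
  destruct (exp_int_lim N HN) as [L HL].
  assert (Hdom : forall t, 0 < t < exp N -> t <> 1 ->
            -1 < scaled_log N t /\ scaled_log N t <> 0 /\ ln t = - N * scaled_log N t).
  { intros t Ht H1.
    assert (E : ln t = - N * scaled_log N t) by (unfold scaled_log; field; lra).
    assert (ln t < N) by (rewrite <- (ln_exp N); apply ln_increasing; lra).
    repeat split; [nra | | exact E].
    intros E0; rewrite E0 in E; apply (ln_neq_0 t); lra. }
  (* Since [phi] tends to infinity at both ends, [exp_int] contributes the same limit [L] at each,
     and it cancels. *)
  assert (Hli : 0 <= c * (li (exp N) - ((main_prim q d N p (exp N) + L) - (0 + L)))).
  { apply (li_compare c (exp N) (0 + L) _
      (fun t => main_prim q d N p t + exp_int N (phi (scaled_log N t)))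
      (fun t => main_deriv q d N p t
         + - / (N * t) * (scaled_log N t / (1 + scaled_log N t)
             * (exp (- N * phi (scaled_log N t)) / (2 * phi (scaled_log N t)))))); trivial.
    - intros t Ht H1; destruct (Hdom t Ht H1) as (Hs & Hs0 & _).
      apply (is_derive_plus (V := R_NormedModule) (main_prim q d N p)).
      + apply is_derive_main_prim; lra.
      + apply (is_derive_comp (fun s => exp_int N (phi s)) (scaled_log N));
          [|apply is_derive_scaled_log; lra].
        apply (is_derive_comp (exp_int N) phi); [|apply is_derive_phi, Hs].
        apply is_derive_exp_int, phi_pos; assumption.
    - intros t Ht H1; destruct (Hdom t Ht H1) as (Hs & Hs0 & Hln).
      unfold main_deriv; cbv zeta.
      assert (Hexp : exp (- N * phi (scaled_log N t)) = t * (1 + scaled_log N t) ^ S p).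
      { rewrite <- (exp_ln t) at 2 by lra. rewrite Hln.
        rewrite <- (exp_ln ((1 + scaled_log N t) ^ S p)) by (apply pow_lt; lra).
        rewrite ln_pow, <- exp_plus by lra. f_equal; unfold phi; fold N; ring. }
      rewrite Hexp, Hln.
      specialize (HQ _ Hs Hs0). pose proof (phi_pos _ Hs Hs0) as Hphi.
      set (s := scaled_log N t) in *.
      assert (Hgeo : sum_f_R0 (fun k => (1 + s) ^ k) p = ((1 + s) ^ S p - 1) / s).
      { pose proof (GP_finite (1 + s) p) as G; rewrite Nat.add_1_r in G.
        rewrite <- G; field; exact Hs0. }
      rewrite Hgeo; simpl (_ ^ S p).
      assert (Hy : 0 < (1 + s) ^ p) by (apply pow_lt; lra).
      set (X := (1 + s) ^ p) in *.
      (* The terms y / s and the geometric sum cancel, leaving y^p / N times the kernel difference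
         assumed in [HQ]. *)
      match goal with |- 0 <= c * ?e =>
        replace (c * e) with (X / N * (c * (s / (2 * phi s) - Qpoly q d s / s))) end.
      + apply Rmult_le_pos; [left; apply Rdiv_lt_0_compat; lra | exact HQ].
      + unfold Qpoly; field; repeat split; lra.
    - apply filterlim_Rplus; [apply filterlim_main_prim_0; lra|].
      eapply filterlim_comp; [apply filterlim_phi_at_0; lra | exact HL].
    - apply filterlim_Rplus.
      + eapply filterlim_derive_within, is_derive_main_prim; lra.
      + eapply filterlim_comp; [apply filterlim_phi_at_end; lra | exact HL].
    - apply filterlim_ext with (fun h =>
        (main_prim q d N p (1 - h) - main_prim q d N p (1 + h))
        + (exp_int N (phi (scaled_log N (1 - h))) - exp_int N (phi (scaled_log N (1 + h))))).
      { intros h; ring. }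
      replace (locally 0) with (locally (0 + 0)) by (rewrite Rplus_0_r; reflexivity).
      apply filterlim_Rplus; [|apply filterlim_exp_int_pv; lra].
      apply filterlim_pv_continuous, (ex_derive_continuous (main_prim q d N p)).
      eexists; apply is_derive_main_prim; lra. }
  (* The logarithm is exactly the integer N, so the interpolation term of the Stieltjes
     approximation vanishes. *)
  assert (Hst : li_stieltjes (exp N)
                = exp N / N * sum_f_R0 (fun k => INR (fact k) / N ^ k) p).
  { assert (Hns : nstar (exp N) = S p).
    { unfold nstar, N; rewrite ln_exp, INR_IZR_INZ, ZfloorZ, Nat2Z.id; reflexivity. }
    unfold li_stieltjes; rewrite Hns, ln_exp; fold N.
    rewrite Nat.sub_succ, Nat.sub_0_r.
    unfold Rdiv at 1; ring. }
  unfold stieltjes_error_exp, stieltjes_error; fold N.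
  rewrite Hst; unfold N in Hli at 2; rewrite main_prim_end in Hli; fold N in Hli.
  lra.
Qed.

(** * Numerical conclusion *)

Theorem mainTheorem2 (n : nat) (hn : (1000 < n)%nat) :
  1 / 3 * sqrt (2 * PI / INR n) - 0.0000035462 <= stieltjes_error_exp n /\
  stieltjes_error_exp n <= 1 / 3 * sqrt (2 * PI / INR n) + 0.0000021511.
Proof.
  destruct n as [|p]; [lia|].
  pose proof (stieltjes_error_compare 1 (1 / 60) (-1) p) as Hu.
  pose proof (stieltjes_error_compare (-1) (1 / 30) 1 p) as Hl.
  cbv zeta in Hu, Hl.
  specialize (Hu ltac:(intros s Hs H0; pose proof (Qpoly_upper s Hs H0); lra)).
  specialize (Hl ltac:(intros s Hs H0; pose proof (Qpoly_lower s Hs H0); lra)).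
  destruct (stirling_ratio_bounds (S p) ltac:(lia)) as [Sl Su].
  assert (HN : 1001 <= INR (S p)).
  { replace 1001 with (INR 1001) by (rewrite INR_IZR_INZ; reflexivity). apply le_INR; lia. }
  set (N := INR (S p)) in *; set (M := stirling_ratio (S p)) in *.
  set (e := stieltjes_error_exp (S p)) in *.
  set (i := / N).
  assert (Hi : 0 < i <= / 1001)
    by (split; [apply Rinv_0_lt_compat | apply Rinv_le_contravar]; lra).
  (* From PI <= 4: 8/1001 < (9/100)^2. *)
  assert (Hr : 0 <= sqrt (2 * PI / N) <= 9 / 100).
  { split; [apply sqrt_pos|].
    rewrite <- (sqrt_Rsqr (9 / 100)) by lra. apply sqrt_le_1_alt.
    unfold Rdiv at 1; fold i. pose proof PI_4; pose proof PI_RGT_0; unfold Rsqr; nra. }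
  set (r := sqrt (2 * PI / N)) in *.
  replace (1 / 60 / N) with (1 / 60 * i) in Hu by (unfold i; field; lra).
  replace (1 / 30 / N) with (1 / 30 * i) in Hl by (unfold i; field; lra).
  replace (3 / N ^ 2 + 6 / N ^ 3) with (3 * i ^ 2 + 6 * i ^ 3) in * by (unfold i; field; lra).
  replace (1 / (12 * N)) with (i / 12) in * by (unfold i; field; lra).
  (* From exp (i/12) <= 1 / (1 - i/12); the slope 101/1200 slightly exceeds 1/12 to absorb the
     higher-order terms. *)
  assert (Hexp : exp (i / 12) <= 1 + 101 / 1200 * i).
  { assert (Hinv : exp (i / 12) * exp (- (i / 12)) = 1)
      by (rewrite <- exp_plus, Rplus_opp_r; apply exp_0).
    pose proof (exp_ineq1_le (- (i / 12))). pose proof (exp_pos (i / 12)).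
    apply Rmult_le_reg_r with (1 - i / 12); [lra|].
    apply Rle_trans with 1; nra. }
  assert (Hri : 0 <= r * i <= 9 / 100100) by (split; nra).
  assert (Hpoly : 0 <= 3 * i ^ 2 + 6 * i ^ 3 <= 31 / 10000 * i) by (split; nra).
  set (b := 3 * i ^ 2 + 6 * i ^ 3) in *.
  clearbody b; clearbody i r M e; clear N HN.
  assert (HM : M <= r * (1 + 101 / 1200 * i)).
  { apply Rle_trans with (1 := Su), Rmult_le_compat_l; lra. }
  split.
  (* The loss is at most r i (1/30 + 31/10000), below 0.0000033. *)
  - assert (r * (1 / 3 - 1 / 30 * i - 1 * b) <= M * (1 / 3 - 1 / 30 * i - 1 * b))
      by (apply Rmult_le_compat_r; lra).
    assert (r * b <= r * (31 / 10000 * i)) by (apply Rmult_le_compat_l; lra).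
    lra.
  - assert (M * (1 / 3 - 1 / 60 * i - -1 * b)
            <= r * (1 + 101 / 1200 * i) * (1 / 3 - 1 / 60 * i - -1 * b))
      by (apply Rmult_le_compat_r; lra).
    (* The linear part is 101/3600 - 1/60 + 31/10000, about 0.01449; rounding up to 0.0146 covers
       the cross terms and gives an excess below 0.0000014. *)
    assert (r * (1 + 101 / 1200 * i) * (1 / 3 - 1 / 60 * i - -1 * b)
            <= r * (1 / 3 + 146 / 10000 * i)).
    { rewrite Rmult_assoc; apply Rmult_le_compat_l; [lra|]. nra. }
    lra.
Qed.
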